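(* In the case of one covariate, if the covariate has finite variance, then the balance $B$ of the allocation produced by the greedy pair-switching algorithm on $2n$ individuals satisfies $B=O_p(n^{-3})$ as $n\to\infty$.
   Context: One-covariate setting: the covariate values of the $2n$ individuals are independent, identically distributed, absolutely continuous real random variables with a uniformly continuous density. An allocation assigns $n$ of the $2n$ individuals to treatment and the other $n$ to control. The balance of an allocation is $B=\left|\frac{\overline{X_T}-\overline{X_C}}{s}\right|$, where $\overline{X_T}$, $\overline{X_C}$ are the average covariate values in the treatment and control groups and $s$ is the standard deviation of the covariate over all $2n$ individuals. Greedy pair-switching algorithm: (1) choose an initial allocation uniformly at random among all $\binom{2n}{n}$ allocations (independently of the covariate values); (2) among all $n^2$ possible switches of one individual currently in treatment with one individual currently in control, find the one whose resulting allocation has the smallest $B$; (3) if that value of $B$ is strictly less than the current one, make the switch and return to (2); otherwise stop and output the current allocation. $Z_n=O_p(a_n)$ means that $Z_n/a_n$ is bounded in probability. *)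

(* Defs.v *)
From HB Require Import structures.
From mathcomp Require Import all_boot all_order all_algebra.
From mathcomp Require Import all_classical all_reals all_analysis.

Set Implicit Arguments.
Unset Strict Implicit.
Unset Printing Implicit Defensive.

Import Order.TTheory GRing.Theory Num.Theory.
Import numFieldNormedType.Exports.

Local Open Scope classical_set_scope.
Local Open Scope ring_scope.

(* An allocation is identified with its treatment group; the control group is
   the complement. *)
Definition allocation (n : nat) := {A : {set 'I_(2 * n)} | #|A| == n}.

Section Balance.
Context {R : realType} {n : nat}.
Implicit Types (x : 'I_(2 * n) -> R) (A : allocation n).

Definition mean_treated x A : R := (\sum_(i in val A) x i) / n%:R.

Definition mean_control x A : R := (\sum_(i in ~: val A) x i) / n%:R.

Definition mean_all x : R := (\sum_i x i) / (2 * n)%:R.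

Definition stdev x : R :=
  Num.sqrt ((\sum_i (x i - mean_all x) ^+ 2) / (2 * n)%:R).

Definition balance x A : R :=
  `|(mean_treated x A - mean_control x A) / stdev x|.

End Balance.

Definition is_switch {n : nat} (A A' : allocation n) : Prop :=
  exists i j, [/\ i \in val A, j \notin val A & val A' = j |: (val A :\ i)].

Definition best_switch {R : realType} {n : nat} (x : 'I_(2 * n) -> R)
    (A A' : allocation n) : Prop :=
  is_switch A A' /\
  forall A'', is_switch A A'' -> balance x A' <= balance x A''.

(* [greedy_run x A0 A]: started at A0, the algorithm can output A.  It is a
   relation because the smallest balance may be attained by several switches
   (always so for n = 2: switching i with j, or the two other individuals with
   each other, gives complementary allocations); no tie-breaking rule is
   imposed. *)
Inductive greedy_run {R : realType} {n : nat} (x : 'I_(2 * n) -> R) :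
    allocation n -> allocation n -> Prop :=
| greedy_stop A :
    (forall A', is_switch A A' -> balance x A <= balance x A') ->
    greedy_run x A A
| greedy_step A A' A'' :
    best_switch x A A' -> balance x A' < balance x A ->
    greedy_run x A' A'' -> greedy_run x A A''.

Lemma greedy_run_exists {R : realType} {n : nat} (x : 'I_(2 * n) -> R)
  (A0 : allocation n) : exists A, greedy_run x A0 A.
Proof.
have [k] := ubnP #|[set A | balance x A < balance x A0]|%SET.
elim: k A0 => // k IH A0 ltk.
have [stop|/existsNP[A1 /not_implyP[sw1 /negP]]] :=
    pselect (forall A', is_switch A0 A' -> balance x A0 <= balance x A').
  by exists A0; exact: greedy_stop.
rewrite -ltNge => lt1.
have sw1b : `[< is_switch A0 A1 >] by exact/asboolP.
case: (@arg_minP _ _ _ A1 (fun A => `[< is_switch A0 A >])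
  (fun A => balance x A) sw1b) => A2 /asboolP sw2 min2.
have lt2 : balance x A2 < balance x A0.
  exact: le_lt_trans (min2 _ sw1b) lt1.
have [|A run] := IH A2.
  rewrite -ltnS; apply: leq_trans ltk; rewrite ltnS; apply: proper_card.
  apply/properP; split; last by exists A2; rewrite !inE ?lt2 ?ltxx.
  by apply/fintype.subsetP => A; rewrite !inE => /lt_trans; exact.
exists A; apply: (greedy_step (A' := A2)) => //; split=> // A3 sw3.
by apply: min2; exact/asboolP.
Qed.

Section Probability.
Context {d : measure_display} {Omega : measurableType d} {R : realType}.
Variable P : probability Omega R.

Definition has_density (X : {RV P >-> R}) (f : R -> R) : Prop :=
  [/\ measurable_fun setT f, forall t, 0 <= f t &
      forall B, measurable B ->
        (distribution P X B = \int[lebesgue_measure]_(t in B) (f t)%:E)%E].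

Definition mutually_independent {I : finType} (X : I -> {RV P >-> R}) : Prop :=
  forall (J : {set I}) (B : I -> set R), (forall i, measurable (B i)) ->
    (P (\bigcap_(i in [set` J]) (X i @^-1` B i)) =
     \prod_(i in J) P (X i @^-1` B i))%E.

(* A random element of a finite type: all its level sets are events. *)
Definition finite_valued_rv {T : finType} (Y : Omega -> T) : Prop :=
  forall y, measurable (Y @^-1` [set y]).

Definition uniform_allocation {n : nat} (Y : Omega -> allocation n) : Prop :=
  forall A, P (Y @^-1` [set A]) = (('C(2 * n, n)%:R)^-1)%:E.

(* Independence of Y from the vector (X_0, ..., X_(m-1)), i.e. from the
   sigma-algebra this vector generates. *)
Definition independent_of {T : finType} {m : nat} (Y : Omega -> T)
    (X : 'I_m -> {RV P >-> R}) : Prop :=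
  forall y E, g_sigma_preimage (fun i => X i : Omega -> R) E ->
    (P (Y @^-1` [set y] `&` E) = P (Y @^-1` [set y]) * P E)%E.

(* Z_n = O_p(a_n). *)
Definition bigO_in_probability (Z : nat -> Omega -> R) (a : nat -> R) : Prop :=
  forall e : R, 0 < e -> exists M : R,
    \forall n \near \oo, (P [set w | (M < `|Z n w / a n|)%R] <= e%:E)%E.

End Probability.

Arguments has_density {d Omega R} P X f.
Arguments mutually_independent {d Omega R} P {I} X.
Arguments uniform_allocation {d Omega R} P {n} Y.
Arguments independent_of {d Omega R} P {T m} Y X.
Arguments bigO_in_probability {d Omega R} P Z a.

(* Main.v *)
(* Write S for the difference of the covariate sums of the two groups; switching i
   and j replaces S by S - 2 (x i - x j), and the balance is |S| / (n s).  Fix the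
   initial allocation, which is independent of the covariates, and an interval on
   which the density is bounded above and away from 0.

   The law of large numbers gives |S| = o(n) at the start.  As long as |S| stays
   above a constant it drops by a constant at each switch, so that o(n) switches
   are made, and none of them touches the interior of the interval: there every
   individual has neighbours of its own group on both sides, which would be better
   choices.  Three further switches then bring |S| below some w with
   n^(-2) << w << n^(-3/2), since second moments show that, uniformly over the
   possible targets, some untouched pair has a difference close enough to S / 2.

   Below w there are no three close individuals, so that the close pairs are
   disjoint.  Let D_k be the untouched initial treatment-control pairs with
   difference between w 2^(-k) / 2 and w 2^(-k).  Before |S| drops below w 2^(-k)
   the algorithm switches at most two pairs of D_k, and it cannot stop while one of
   suitable sign is left.  So it reaches the smallest scale for which all the D_k
   are rich enough; by Chebyshev's inequality D_k is too poor with probability of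
   order 1 / (n^2 w 2^(-k)), which sums to 1 / M when the last scale is M / n^2. *)
Require Import Defs.
From HB Require Import structures.
From mathcomp Require Import all_boot all_order all_algebra.
From mathcomp Require Import all_classical all_reals all_analysis.
From mathcomp Require Import measurable_realfun.
From mathcomp Require Import ring lra zify.
Set Implicit Arguments.
Unset Strict Implicit.
Unset Printing Implicit Defensive.
Import Order.TTheory GRing.Theory Num.Theory.
Import numFieldNormedType.Exports.
Local Open Scope classical_set_scope.
Local Open Scope ring_scope.

(** * The greedy algorithm in terms of signed imbalances *)

(** The obstacle is adaptivity: the switches made depend on all the covariates, so nothing stays
    independent along the run. Hence every random estimate concerns the initial allocation alone and
    covers all targets that the run might ask for, in each of several disjoint blocks of the
    interval. The run itself is treated deterministically, and an estimate is used in a block where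
    everyone is still in the initial group. Uniformity over targets dictates the three jumps. Going
    from imbalance H to w takes about H / w targets, each missed with probability of order 1 / (n^2
    w) + 1 / n. From a constant H this allows w down to n^(-1), from there n^(-3/2), from there
    n^(-7/4), limits excluded. Two jumps thus cannot get below n^(-3/2), where close triples (about
    n^3 w^2 of them) disappear; three can. The scales n^(-18/20), n^(-28/20) and n^(-33/20) keep a
    margin from these limits, hence an integer z with n of order z^20. *)

Definition swap {T : finType} (A : {set T}) (i j : T) : {set T} :=
  (j |: (A :\ i))%SET.

Definition imbalance {R : realType} {T : finType} (x : T -> R) (A : {set T}) : R :=
  \sum_(i in A) x i - \sum_(i in (~: A)%SET) x i.

Section Swap.
Context {R : realType} {T : finType}.
Implicit Types (x : T -> R) (A : {set T}).

Lemma swap_stable A i j k : k != i -> k != j -> (k \in swap A i j) = (k \in A).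
Proof. by rewrite /swap !inE => /negPf -> /negPf ->. Qed.

Lemma imbalanceE x A : imbalance x A = 2 * (\sum_(i in A) x i) - \sum_i x i.
Proof.
rewrite /imbalance [X in _ = _ - X](bigID (mem A)) /=.
rewrite [X in _ = _ - (_ + X)](eq_bigl (mem (~: A)%SET)); last by move=> i; rewrite !inE.
by rewrite mulr_natl mulr2n; lra.
Qed.

Lemma imbalance_swap x A i j : i \in A -> j \notin A ->
  imbalance x (swap A i j) = imbalance x A - 2 * (x i - x j).
Proof.
move=> iA jA; rewrite !imbalanceE /swap.
rewrite big_setU1; last by rewrite !inE (negPf jA) andbF.
by rewrite [in RHS](big_setD1 i)//=; lra.
Qed.

Lemma card_swap A i j : i \in A -> j \notin A -> #|swap A i j| = #|A|.
Proof.
move=> iA jA; rewrite /swap cardsU1 !inE (negPf jA) andbF/=.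
by rewrite [in RHS](cardsD1 i) iA.
Qed.

End Swap.

Definition optimal_pick {R : realType} {T : finType} (x : T -> R)
    (A A' : {set T}) (i j : T) :=
  [/\ i \in A, j \notin A, A' = swap A i j,
      `|imbalance x A'| < `|imbalance x A| &
      forall a b, a \in A -> b \notin A ->
        `|imbalance x A'| <= `|imbalance x A - 2 * (x a - x b)|].

Definition no_better_switch {R : realType} {T : finType} (x : T -> R)
    (A : {set T}) :=
  forall a b, a \in A -> b \notin A ->
    `|imbalance x A| <= `|imbalance x A - 2 * (x a - x b)|.

Section GreedyPick.
Context {R : realType} {n : nat}.
Variable x : 'I_(2 * n) -> R.
Hypotheses (n_gt0 : (0 < n)%N) (sd_gt0 : 0 < stdev x).

Lemma balanceE (A : allocation n) :
  balance x A = `|imbalance x (val A)| / (n%:R * stdev x).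
Proof.
rewrite /balance /mean_treated /mean_control -mulrBl -/(imbalance x (val A)).
have n0 : (0 : R) < n%:R by rewrite ltr0n.
by rewrite !normrM !normfV (gtr0_norm n0) (gtr0_norm sd_gt0) invfM mulrA.
Qed.

Lemma ler_balance (A B : allocation n) : (balance x A <= balance x B) =
  (`|imbalance x (val A)| <= `|imbalance x (val B)|).
Proof. by rewrite !balanceE ler_pM2r// invr_gt0 mulr_gt0 ?ltr0n. Qed.

Lemma is_switch_swap (A : allocation n) i j : i \in val A -> j \notin val A ->
  exists2 A', is_switch A A' & val A' = swap (val A) i j.
Proof.
move=> iA jA.
have cA : #|swap (val A) i j| == n by rewrite card_swap// (eqP (valP A)).
by exists (Sub (swap (val A) i j) cA) => //; exists i, j.
Qed.

Lemma best_switch_optimal (A A' : allocation n) :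
  best_switch x A A' -> balance x A' < balance x A ->
  exists i j, optimal_pick x (val A) (val A') i j.
Proof.
move=> [[i [j [iA jA eA']]] best]; rewrite ltNge ler_balance -ltNge => lt.
exists i, j; split => // a b aA bA.
have [A2 sw2 eA2] := is_switch_swap aA bA.
by have := best _ sw2; rewrite ler_balance eA2 imbalance_swap.
Qed.

Lemma greedy_stop_no_better (A : allocation n) :
  (forall A', is_switch A A' -> balance x A <= balance x A') ->
  no_better_switch x (val A).
Proof.
move=> stop a b aA bA; have [A2 sw2 eA2] := is_switch_swap aA bA.
by have := stop _ sw2; rewrite ler_balance eA2 imbalance_swap.
Qed.

Lemma greedy_run_inv (A B : allocation n) : greedy_run x A B ->
  (B = A /\ no_better_switch x (val A)) \/
  exists A' i j, optimal_pick x (val A) (val A') i j /\ greedy_run x A' B.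
Proof.
case=> {A B} [A stop|A A' B best lt run]; first by left; split => //;
  exact: greedy_stop_no_better.
by right; have [i [j p]] := best_switch_optimal best lt; exists A', i, j.
Qed.

(** [C] is an early exit: a step may leave the invariant if the rest of the run, available to
    [stepC], already yields the goal. The coarse phase ends this way, whereas the fine phase keeps
    its invariant until the stop. *)
Lemma greedy_run_invariant (Q : {set 'I_(2 * n)} -> Prop) (B : allocation n) (C : Prop) :
  (Q (val B) -> no_better_switch x (val B) -> C) ->
  (forall A A' : allocation n, forall i j, greedy_run x A' B -> Q (val A) ->
     optimal_pick x (val A) (val A') i j -> C \/ Q (val A')) ->
  forall A, greedy_run x A B -> Q (val A) -> C.
Proof.
move=> stopC stepC A run; elim: run stopC stepC =>
  {A B} [A stop|A A' B best lt run IH] stopC stepC QA.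
  exact/stopC/greedy_stop_no_better.
have [i [j p]] := best_switch_optimal best lt.
by have [//|] := stepC _ _ _ _ run QA p; exact: IH.
Qed.

End GreedyPick.

(** * Small imbalances *)

Lemma norm_signE {R : realType} (D : R) : `|D| = (-1) ^+ (D < 0)%R * D.
Proof.
case: ltP => D0 /=; first by rewrite expr1 mulN1r ltr0_norm.
by rewrite expr0 mul1r ger0_norm.
Qed.

(** A strict decrease of |S| to |S - 2 d| forces d to have the sign of S and to be smaller than S in
    absolute value. Orienting by [s] turns later comparisons into comparisons of positive
    numbers. *)
Lemma optimal_pick_sign {R : realType} {T : finType} (x : T -> R) A A' i j :
  optimal_pick x A A' i j -> exists s : bool,
  [/\ `|imbalance x A| = (-1) ^+ s * imbalance x A,
      0 < (-1) ^+ s * (x i - x j),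
      (-1) ^+ s * (x i - x j) < `|imbalance x A| &
      `|imbalance x A'| = `| `|imbalance x A| - 2 * ((-1) ^+ s * (x i - x j))|].
Proof.
move=> [iA jA -> lt _]; rewrite imbalance_swap// in lt *.
have [S0|S0] := leP 0 (imbalance x A).
  exists false; rewrite expr0 !mul1r ger0_norm//; rewrite [ltRHS]ger0_norm// in lt.
  by move: lt; rewrite ltr_norml => /andP[? ?]; split => //; lra.
exists true; rewrite expr1 !mulN1r ltr0_norm//; rewrite [ltRHS]ltr0_norm// in lt.
move: (lt); rewrite ltr_norml => /andP[? ?]; split => //; [lra|lra|].
by rewrite -normrN; congr `|_|; lra.
Qed.

Lemma optimal_pick_best {R : realType} {T : finType} (x : T -> R) A A' i j s a b :
  `|imbalance x A| = (-1) ^+ (s : bool) * imbalance x A ->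
  optimal_pick x A A' i j -> a \in A -> b \notin A ->
  `|imbalance x A'| <= `| `|imbalance x A| - 2 * ((-1) ^+ s * (x a - x b))|.
Proof.
move=> es [_ _ _ _ best] aA bA; apply: (le_trans (best _ _ aA bA)).
rewrite es; set S := imbalance x A.
rewrite [X in _ <= `|X|](_ : _ = (-1) ^+ s * (S - 2 * (x a - x b))); last first.
  by rewrite [RHS]mulrBr [in RHS]mulrCA.
by rewrite normrM normrX normrN1 expr1n mul1r.
Qed.

Section Fine.
Context {R : realType} {T : finType} {b : nat}.
Variables (x : T -> R) (lab : T -> nat) (tau : nat -> R) (J : nat) (P : {set 'I_b}).
Hypothesis tau_gt0 : forall k, 0 < tau k.
Hypothesis tau_half : forall k, tau k = 2 * tau k.+1.
Hypothesis no_triple : forall i j l, (lab i < b)%N -> i != j -> i != l -> j != l ->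
  `|x i - x j| <= tau 0 -> `|x i - x l| <= tau 0 -> False.

(** Pairs are recorded by their block: pairs in distinct blocks are disjoint, and a switch that
    kills a pair names the block through [lab i]. Both signs are required because the sign of the
    imbalance at the time of use is unknown. *)
Definition alive (k : nat) (A : {set T}) (r : 'I_b) : bool :=
  [forall s : bool, [exists u, [exists v, [&& u \in A, v \notin A, lab u == r,
    lab v == r & tau k / 2 < (-1) ^+ s * (x u - x v) < tau k]]]].

Lemma aliveP k (A : {set T}) (r : 'I_b) : reflect (forall s : bool, exists u v,
    [/\ u \in A, v \notin A, lab u = r, lab v = r &
        tau k / 2 < (-1) ^+ s * (x u - x v) < tau k])
  (alive k A r).
Proof.
apply: (iffP forallP) => H s.
  have /existsP[u /existsP[v /and5P[? ? /eqP ? /eqP ? ?]]] := H s.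
  by exists u, v.
have [u [v [? ? /eqP ? /eqP ? ?]]] := H s.
by apply/existsP; exists u; apply/existsP; exists v; apply/and5P.
Qed.

Definition dead (k : nat) (A : {set T}) : {set 'I_b} :=
  [set r in P | ~~ alive k A r]%SET.

(* At scale tau k the pairs of D_k (see the header) are at least tau k / 2 apart,
   so flipping one costs at least tau k of imbalance; and a D_k pair is only ever
   flipped when the new imbalance is below 3 tau k, for otherwise a pair of
   D_(k-1) would be a better choice.  Hence at most two D_k pairs die before the
   imbalance reaches tau k. *)
Definition fine_inv (A : {set T}) := `|imbalance x A| <= tau 0 /\
  forall k, (k <= J)%N -> [\/ `|imbalance x A| <= tau k, #|dead k A| = 0%N |
    `|imbalance x A| <= (4 - #|dead k A|%:R) * tau k].

Lemma tau_le0 k : tau k <= tau 0.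
Proof.
elim: k => // k IH; apply: le_trans IH; rewrite [leRHS]tau_half.
by have := tau_gt0 k.+1; lra.
Qed.

Hypothesis P_ge3 : (3 <= #|P|)%N.

(** Above [tau k], the bound with the constant 4 leaves room for at most two dead blocks, while [P]
    has at least three. *)
Lemma exists_alive A k : fine_inv A -> (k <= J)%N -> tau k < `|imbalance x A| ->
  exists r, alive k A r.
Proof.
move=> [_ inv] kJ lt.
have dlt : (#|dead k A| < #|P|)%N.
  apply: leq_trans P_ge3; have [|->//|] := inv k kJ; first by rewrite leNgt lt.
  move=> le; rewrite ltnNge; apply/negP => d3.
  have : (3 : R) <= #|dead k A|%:R by rewrite ler_nat.
  move=> d3'; move: (lt_le_trans lt le); have := tau_gt0 k; nra.
apply: contrapT => /forallNP noalive; move: dlt; rewrite ltnNge => /negP; apply.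
apply: subset_leq_card; apply/fintype.subsetP => r rP; rewrite inE rP/=.
by apply/negP => /noalive.
Qed.

(* Without close triples, the only small switch that touches an alive pair is the
   switch of that very pair. *)
Lemma newly_dead A A' i j k (r : 'I_b) : fine_inv A -> optimal_pick x A A' i j ->
  alive k A r -> ~~ alive k A' r ->
  lab i = r /\ exists s : bool, tau k / 2 < (-1) ^+ s * (x i - x j) < tau k.
Proof.
move=> [S0 _] pick /aliveP al /aliveP nal.
move: nal => /existsNP[s nal]; have [u [v [uA vA lu lv uv]]] := al s.
have uvle : `|x u - x v| <= tau 0.
  have [uv1 uv2] := andP uv; have t0 := tau_gt0 k.
  rewrite -[x u - x v](signrMK s) normrM normrX normrN1 expr1n mul1r.
  by rewrite gtr0_norm; [have := tau_le0 k; lra|lra].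
have [iA jA eA' _ _] := pick.
have ijle : `|x i - x j| <= tau 0.
  have [s' [_ d0 dS _]] := optimal_pick_sign pick.
  rewrite -[x i - x j](signrMK s') normrM normrX normrN1 expr1n mul1r.
  by rewrite gtr0_norm//; lra.
have uvN : u != v by apply: contraNneq vA => <-.
have ijN : i != j by apply: contraNneq jA => <-.
have iv : i != v by apply: contraNneq vA => <-.
have uj : u != j by apply: contraNneq jA => <-.
have [ui|ui] := eqVneq u i.
  have [vj|vj] := eqVneq v j; first by subst; split => //; exists s.
  subst u; exfalso.
  by apply: (no_triple (i := i) (j := v) (l := j)); rewrite // ?lu.
have [vj|vj] := eqVneq v j.
  subst v; exfalso.
  by apply: (no_triple (i := j) (j := u) (l := i)); rewrite // ?lv// 1?distrC// 1?eq_sym.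
exfalso; apply: nal; exists u, v.
by rewrite eA' !swap_stable// eq_sym.
Qed.

Lemma fine_step A A' i j : fine_inv A -> optimal_pick x A A' i j -> fine_inv A'.
Proof.
move=> inv pick; have [S0 invA] := inv.
have [_ _ _ ltS _] := pick.
split=> [|k kJ]; first exact: le_trans (ltW ltS) S0.
have [|ltk] := leP `|imbalance x A'| (tau k); first by constructor 1.
have [sub|/fintype.subsetPn[r rd' rd]] := boolP (dead k A' \subset dead k A).
  have cle := subset_leq_card sub.
  have [|d0|d4] := invA k kJ.
  - by move=> le; exfalso; move: (lt_trans ltk ltS); rewrite ltNge le.
  - by constructor 2; apply/eqP; move: cle; rewrite d0 leqn0.
  - constructor 3; apply: (le_trans (ltW ltS)); apply: (le_trans d4).
    rewrite ler_pM2r//; have : (#|dead k A'|%:R : R) <= #|dead k A|%:R by rewrite ler_nat.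
    by lra.
have new r' : r' \in dead k A' -> r' \notin dead k A ->
    lab i = r' /\ exists s : bool, tau k / 2 < (-1) ^+ s * (x i - x j) < tau k.
  rewrite !inE => /andP[-> nal]; rewrite /= negbK => al.
  exact: newly_dead inv pick al nal.
have [labi [s /andP[uv1 uv2]]] := new _ rd' rd.
(* Every newly dead block carries the label of [i], so one switch kills at most one. *)
have cle : (#|dead k A'| <= #|dead k A|.+1)%N.
  have : dead k A' \subset r |: dead k A.
    apply/fintype.subsetP => r' r'd; rewrite in_setU1.
    have [//|r'nd] := boolP (r' \in dead k A); first by rewrite orbT.
    by have [lr' _] := new _ r'd r'nd; rewrite (_ : r' = r) ?eqxx//; apply/val_inj;
      rewrite /= -lr' -labi.
  move=> /subset_leq_card /leq_trans; apply; rewrite cardsU1.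
  by case: (_ \notin _).
have [s' [eS d0 dS eS']] := optimal_pick_sign pick.
have ed : (-1) ^+ s' * (x i - x j) = (-1) ^+ s * (x i - x j).
  have t0 := tau_gt0 k.
  move: d0 uv1; case: (s) (s') => [] [] //=; rewrite !expr1 !expr0; lra.
rewrite ed in d0 dS eS'; set d := (-1) ^+ _ * _ in uv1 uv2 d0 dS eS'.
(* An overshoot would leave 2 d - |S| < d < [tau k], since d < |S|; this contradicts [ltk]. *)
have eS2 : `|imbalance x A'| = `|imbalance x A| - 2 * d.
  have [h|h] := leP (2 * d) `|imbalance x A|; first by rewrite eS'; apply: ger0_norm;
    rewrite subr_ge0.
  have h' : `|imbalance x A| - 2 * d < 0 by rewrite subr_lt0.
  by exfalso; move: ltk; rewrite eS' (ltr0_norm h'); lra.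
constructor 3.
have cleR : (#|dead k A'|%:R : R) <= #|dead k A|%:R + 1.
  by rewrite natr1 ler_nat.
have [|d00|d4] := invA k kJ.
- by move=> le; exfalso; move: (lt_trans ltk ltS); rewrite ltNge le.
(* The first death. If more than [3 * tau k] remained, a pair alive one level up, with difference
   between [tau k] and [2 * tau k], would beat the switch, whose d is below [tau k]. At level 0 the
   imbalance is at most [tau 0] anyway. *)
- rewrite d00 in cleR; apply: (@le_trans _ _ (3 * tau k)); last first.
    by rewrite ler_pM2r//; lra.
  have [//|lt3] := leP `|imbalance x A'| (3 * tau k); exfalso.
  case: k kJ => [|k] kJ in ltk rd' rd new uv1 uv2 cle d00 cleR lt3 *.
    by have := tau_gt0 0; lra.
  have tk := tau_half k; have tk0 := tau_gt0 k.
  have [|r' /aliveP/(_ s')[u [v [uA vA _ _ /andP[uv3 uv4]]]]] := @exists_alive A k inv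
    (ltnW kJ).
    by lra.
  have := optimal_pick_best eS pick uA vA; apply/negP; rewrite -ltNge.
  set e := (-1) ^+ _ * _ in uv3 uv4 *.
  by rewrite ltr_norml; apply/andP; split; lra.
- apply: (le_trans _ (_ : (3 - #|dead k A|%:R) * tau k <= _)).
    by rewrite eS2; lra.
  by rewrite ler_pM2r//; lra.
Qed.

Lemma fine_stop A : fine_inv A -> no_better_switch x A -> `|imbalance x A| <= tau J.
Proof.
move=> inv stop; have [//|ltJ] := leP `|imbalance x A| (tau J); exfalso.
have [r /aliveP al] := exists_alive inv (leqnn J) ltJ.
pose s := imbalance x A < 0.
have eS : `|imbalance x A| = (-1) ^+ s * imbalance x A := norm_signE _.
have [u [v [uA vA _ _ /andP[uv1 uv2]]]] := al s.
have := stop u v uA vA; apply/negP; rewrite -ltNge.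
rewrite (_ : imbalance x A - _ =
  (-1) ^+ s * (`|imbalance x A| - 2 * ((-1) ^+ s * (x u - x v)))); last first.
  by rewrite eS [RHS]mulrBr signrMK [X in _ = _ - X]mulrCA signrMK.
rewrite normrM normrX normrN1 expr1n mul1r ltr_norml.
by have := tau_gt0 J; move: uv1 uv2; set e := (-1) ^+ _ * _ => *; apply/andP; split; lra.
Qed.

End Fine.

(** * Large imbalances *)

Lemma norm_overshoot {R : realType} (D e l : R) : 2 * l <= `|D| ->
  (exists2 s : bool, `|D| = (-1) ^+ s * D & 0 < (-1) ^+ s * e < 2 * l) ->
  `|D - 2 * e| < `|D|.
Proof.
move=> lD [s eD /andP[e0 e1]].
have -> : D - 2 * e = (-1) ^+ s * (`|D| - 2 * ((-1) ^+ s * e)).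
  by rewrite eD [RHS]mulrBr signrMK [X in _ = _ - X]mulrCA signrMK.
rewrite normrM normrX normrN1 expr1n mul1r ltr_norml.
by apply/andP; split; lra.
Qed.

Section Stages.
Context {R : realType} {n : nat} {b : nat}.
Variables (x : 'I_(2 * n) -> R) (A0 : {set 'I_(2 * n)}) (lab : 'I_(2 * n) -> nat).
Implicit Types A : {set 'I_(2 * n)}.

Definition moved A : {set 'I_(2 * n)} := [set i | (i \in A) != (i \in A0)]%SET.

Definition unclean A : {set 'I_b} :=
  [set r : 'I_b | [exists i, (lab i == r) && (i \in moved A)]]%SET.

Lemma moved_swap A i j : moved (swap A i j) \subset (moved A :|: [set i; j])%SET.
Proof.
apply/fintype.subsetP => k; rewrite !inE.
have [->|ki] := eqVneq k i; first by rewrite /= !orbT.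
have [->|kj] := eqVneq k j; first by rewrite /= !orbT.
by rewrite /= orbF.
Qed.

Lemma card_moved_swap A i j : (#|moved (swap A i j)| <= #|moved A| + 2)%N.
Proof.
apply: leq_trans (subset_leq_card (moved_swap A i j)) _.
apply: leq_trans (leq_card_setU _ _) _; rewrite leq_add2l cards2.
by case: (_ != _).
Qed.

Lemma unclean_swap_mid A i j : (b <= lab i)%N -> (b <= lab j)%N ->
  unclean (swap A i j) \subset unclean A.
Proof.
move=> bi bj; apply/fintype.subsetP => r; rewrite !inE => /existsP[k /andP[/eqP lk mk]].
apply/existsP; exists k; rewrite lk eqxx/=.
have := fintype.subsetP (moved_swap A i j) _ mk; rewrite !inE => /orP[//|/orP[]] /eqP kk.
  by move: bi; rewrite -kk lk leqNgt ltn_ord.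
by move: bj; rewrite -kk lk leqNgt ltn_ord.
Qed.

Lemma card_unclean_swap A i j : (#|unclean (swap A i j)| <= #|unclean A| + 2)%N.
Proof.
set L := fun k => [set r : 'I_b | lab k == r]%SET.
have cL k : (#|L k| <= 1)%N.
  by apply/card_le1_eqP => r s; rewrite !inE => /eqP lr /eqP ls; apply/val_inj;
    rewrite /= -lr -ls.
apply: (@leq_trans #|unclean A :|: (L i :|: L j)|).
  apply: subset_leq_card; apply/fintype.subsetP => r.
  rewrite !inE => /existsP[k /andP[/eqP lk mk]].
  have := fintype.subsetP (moved_swap A i j) _ mk; rewrite finset.in_setU in_set2.
  case/orP => [mk'|/orP[]/eqP <-]; [|by rewrite lk eqxx !orbT|by rewrite lk eqxx !orbT].
  by apply/orP; left; apply/existsP; exists k; rewrite lk eqxx.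
apply: leq_trans (leq_card_setU _ _) _; rewrite leq_add2l.
by apply: leq_trans (leq_card_setU _ _) _; rewrite -[2%N]/(1 + 1)%N leq_add.
Qed.

Lemma clean_mem A (r : 'I_b) i : r \notin unclean A -> lab i = r ->
  (i \in A) = (i \in A0).
Proof.
rewrite inE => /existsPn cl li; have := cl i.
by rewrite li eqxx/= inE negbK => /eqP.
Qed.

Definition windows (e U : R) := forall (r : 'I_b) (u : R), `|u| <= U ->
  exists i j, [/\ i \in A0, j \notin A0, lab i = r, lab j = r &
                  `|x i - x j - u| <= e].

Lemma windows_clean e U A u : windows e U -> (#|unclean A| < b)%N -> `|u| <= U ->
  exists i j, [/\ i \in A, j \notin A & `|x i - x j - u| <= e].
Proof.
move=> win cl uU.
have [r rcl] : exists r, r \notin unclean A.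
  apply: contrapT => /forallNP all; move: cl; rewrite ltnNge => /negP; apply.
  rewrite -[X in (X <= _)%N](card_ord b); apply: subset_leq_card.
  by apply/fintype.subsetP => r _; apply: contrapT => /negP /all.
have [i [j [iA jA li lj ij]]] := win r u uU.
by exists i, j; rewrite (clean_mem rcl li) (clean_mem rcl lj).
Qed.

Hypotheses (n_gt0 : (0 < n)%N) (sd_gt0 : 0 < stdev x).

(** A pair whose difference is half the imbalance would cancel it. The greedy switch need not be the
    window pair close to this target, but it does at least as well and touches at most two more
    blocks. *)
Lemma jump e U (A B : allocation n) : greedy_run x A B -> windows e U ->
  (#|unclean (val A)| < b)%N -> `|imbalance x (val A)| <= 2 * U ->
  exists A1 : allocation n, [/\ greedy_run x A1 B, `|imbalance x (val A1)| <= 2 * e &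
                 (#|unclean (val A1)| <= #|unclean (val A)| + 2)%N].
Proof.
move=> run win cl SU.
have [le|gt] := leP `|imbalance x (val A)| (2 * e).
  by exists A; rewrite leq_addr.
have [|i [j [iA jA ij]]] := @windows_clean e U (val A) (imbalance x (val A) / 2) win cl.
  by rewrite normrM (ger0_norm (_ : 0 <= 2^-1)) ?invr_ge0//; lra.
have near : `|imbalance x (val A) - 2 * (x i - x j)| <= 2 * e.
  rewrite (_ : _ - _ = - (2 * (x i - x j - imbalance x (val A) / 2))); last by lra.
  by rewrite normrN normrM (ger0_norm (_ : 0 <= 2)) // ler_pM2l.
have [[_ stop]|[A' [k [l [[kA lA eA' _ best] run']]]]] := greedy_run_inv n_gt0 sd_gt0 run.
  by have := stop i j iA jA; lra.
exists A'; split => //; first exact: le_trans (best _ _ iA jA) near.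
by rewrite eA' card_unclean_swap.
Qed.

Section Coarse.
Variables (o lam K : R) (N : nat).

Definition in_cell (c : nat) i := o + c%:R * lam <= x i < o + c.+1%:R * lam.

Hypothesis lam_gt0 : 0 < lam.
Hypothesis many_treated : forall c, (c < N)%N ->
  K < #|[set i in A0 | in_cell c i]%SET|%:R.
Hypothesis many_control : forall c, (c < N)%N ->
  K < #|[set i in ~: A0 | in_cell c i]%SET|%:R.
Hypothesis lab_mid : forall i, (lab i < b)%N ->
  exists c, (c.+2 < N)%N /\ in_cell c.+1 i.
Hypothesis small_start : `|imbalance x A0| <= lam * K.

(** [lab_mid] leaves a cell on each side of the cell of [i]; adjacent half-open cells are strictly
    ordered and together shorter than any gap of [2 * lam]. *)
Lemma adjacent_cell (Q : pred 'I_(2 * n)) i (s : bool) :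
  (forall c, (c < N)%N -> exists2 k, Q k & in_cell c k) -> (lab i < b)%N ->
  exists2 k, Q k & 0 < (-1) ^+ s * (x k - x i) < 2 * lam.
Proof.
move=> occ /lab_mid[c [cN /andP[]]]; rewrite -!natr1 => i1 i2.
case: s.
  have [|k Qk] := occ c; first by lia.
  by rewrite /in_cell -!natr1 => /andP[k1 k2]; exists k => //; rewrite expr1 mulN1r;
    apply/andP; split; lra.
have [|k Qk] := occ c.+2 => //.
by rewrite /in_cell -!natr1 => /andP[k1 k2]; exists k => //; rewrite expr0 mul1r;
  apply/andP; split; lra.
Qed.

(** At most [K] individuals have moved, so a cell with more than [K] initial members of a group
    cannot have lost them all. *)
Lemma occupied A : #|moved A|%:R * lam <= `|imbalance x A0| ->
  (forall c, (c < N)%N -> exists2 k, k \in A & in_cell c k) /\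
  (forall c, (c < N)%N -> exists2 k, k \notin A & in_cell c k).
Proof.
move=> few; have few' : #|moved A|%:R <= K.
  by rewrite -(ler_pM2l lam_gt0) mulrC (le_trans few).
split=> c cN; apply: contrapT => /forall2NP none.
  have := lt_le_trans (many_treated cN) (le_trans _ few'); rewrite ltxx => H.
  apply: notF; apply: H; rewrite ler_nat; apply: subset_leq_card.
  apply/fintype.subsetP => k; rewrite !inE => /andP[kA kc].
  by rewrite kA; case: (none k) => // /negP/negPf ->.
have := lt_le_trans (many_control cN) (le_trans _ few'); rewrite ltxx => H.
apply: notF; apply: H; rewrite ler_nat; apply: subset_leq_card.
apply/fintype.subsetP => k; rewrite !inE => /andP[/negPf kA kc].
by rewrite kA; case: (none k) => // /negP; rewrite negbK => ->.
Qed.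

(* If a switch of i leaves the imbalance at least 2 lam, replacing i by an
   individual of its group in the adjacent cell, on the side dictated by the sign
   of the remaining imbalance, is a strictly better switch. *)
Lemma pick_outside A A' i j : #|moved A|%:R * lam <= `|imbalance x A0| ->
  optimal_pick x A A' i j -> 2 * lam <= `|imbalance x A'| ->
  (b <= lab i)%N /\ (b <= lab j)%N.
Proof.
move=> few [iA jA eA' _ best] big.
have [occA occC] := occupied few.
rewrite eA' imbalance_swap// in best big; set D := _ - _ in best big.
split; rewrite leqNgt; apply/negP => lb.
  have [k kA kD] := adjacent_cell (D < 0) occA lb.
  have := best k j kA jA; apply/negP; rewrite -ltNge.
  rewrite (_ : _ - _ = D - 2 * (x k - x i)); last by rewrite /D; lra.
  by apply: norm_overshoot big _; exists (D < 0); rewrite // -norm_signE.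
have [k kA kD] := adjacent_cell (0 <= D) occC lb.
have := best i k iA kA; apply/negP; rewrite -ltNge.
rewrite (_ : _ - _ = D - 2 * (x j - x k)); last by rewrite /D; lra.
apply: norm_overshoot big _; exists (D < 0); rewrite // -?norm_signE//.
by move: kD; rewrite leNgt; case: (D < 0) => /=;
  rewrite ?expr1 ?expr0 ?mulN1r ?mul1r => /andP[? ?]; apply/andP; split; lra.
Qed.

Lemma coarse e (A B : allocation n) : val A = A0 -> greedy_run x A B ->
  e <= lam / 2 -> windows e (2 * lam) -> (0 < b)%N ->
  exists A1 : allocation n, [/\ greedy_run x A1 B, `|imbalance x (val A1)| <= 4 * lam &
                 (#|unclean (val A1)| <= 2)%N].
Proof.
move=> eA run elam win b0; have lam0 := lam_gt0.
have unclean0 : #|unclean A0| = 0%N.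
  by apply/eqP; rewrite cards_eq0; apply/eqP/setP => r; rewrite !inE;
    apply/existsP => -[i]; rewrite inE eqxx andbF.
have [le4|gt4] := leP `|imbalance x A0| (4 * lam).
  by exists A; rewrite eA unclean0.
(* A switch moves at most two individuals and, in this range, lowers the imbalance by at least
   [2 * lam], so the moves are paid for by the decrease. *)
pose Q A := [/\ 4 * lam < `|imbalance x A|, #|unclean A| = 0%N &
  #|moved A|%:R * lam <= `|imbalance x A0| - `|imbalance x A| ].
have target D : Q D -> exists i j, [/\ i \in D, j \notin D &
    `|imbalance x D - 2 * (x i - x j)| <= `|imbalance x D| - 2 * lam].
  move=> [big cl _].
  pose s := imbalance x D < 0.
  (* With error at most [lam / 2], the target [3 / 2 * lam] gives a difference between [lam] and
     [2 * lam]: an imbalance above [4 * lam] drops by at least [2 * lam] without changing sign. *)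
  have [||i [j [iD jD ij]]] := @windows_clean e _ D ((-1) ^+ s * (3 / 2 * lam)) win.
  - by rewrite cl.
  - by rewrite normrM normrX normrN1 expr1n mul1r gtr0_norm ?mulr_gt0 // ler_pM2r//; lra.
  exists i, j; split => //.
  have := norm_signE (imbalance x D); rewrite -/s => eD.
  have -> : imbalance x D - 2 * (x i - x j) =
    (-1) ^+ s * (`|imbalance x D| - 2 * ((-1) ^+ s * (x i - x j))).
    by rewrite eD [RHS]mulrBr signrMK [X in _ = _ - X]mulrCA signrMK.
  rewrite normrM normrX normrN1 expr1n mul1r.
  have : `|(-1) ^+ s * (x i - x j) - 3 / 2 * lam| <= e.
    apply: le_trans ij; rewrite -[X in `|_ - X|](signrMK s) -mulrBr.
    by rewrite normrM normrX normrN1 expr1n mul1r.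
  set d := (-1) ^+ _ * _; rewrite ler_norml => /andP[d1 d2].
  by rewrite ler_norml; apply/andP; split; lra.
apply: (greedy_run_invariant n_gt0 sd_gt0 (Q := Q)) run _.
- move=> QB stop; have [i [j [iD jD ij]]] := target _ QB.
  by have := stop i j iD jD; lra.
- move=> D A' i j run' QA pick; have [big cl few] := QA.
  have [k [l [kD lD kl]]] := target _ QA.
  have [iA jA eA' _ best] := pick.
  have drop : `|imbalance x (val A')| <= `|imbalance x (val D)| - 2 * lam.
    exact: le_trans (best _ _ kD lD) kl.
  (* The switch that crosses [4 * lam] may use the interior, whence at most two touched blocks;
     before it, [pick_outside] keeps all blocks clean. *)
  have [le|gt] := leP `|imbalance x (val A')| (4 * lam).
    by left; exists A'; split => //; have := card_unclean_swap (val D) i j; rewrite cl eA'.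
  right; split => //.
    have [||bi bj] := pick_outside _ pick.
    - by apply: le_trans few _; rewrite gerBl.
    - by lra.
    apply/eqP; rewrite -leqn0; apply: (@leq_trans #|unclean (val D)|); last by rewrite cl.
    apply: subset_leq_card.
    by rewrite eA' unclean_swap_mid.
  have : (#|moved (val A')|%:R : R) <= #|moved (val D)|%:R + 2.
    by rewrite -natrD ler_nat eA' card_moved_swap.
  by move=> mle; have := ler_wpM2r (ltW lam_gt0) mle; lra.
- rewrite eA; split => //; rewrite subrr.
  have -> : moved A0 = finset.set0 by apply/setP => i; rewrite !inE eqxx.
  by rewrite cards0 mul0r.
Qed.

End Coarse.

End Stages.

(** * Cells, blocks and windows *)

Lemma window_offset (s : bool) (c m q : nat) : (c < m)%N -> (q <= m)%N ->
  (c + (if s then 0 else q) < 2 * m)%N /\ (c + (if s then q else 0) < 2 * m)%N.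
Proof. by case: s; lia. Qed.

Section GreedyBound.
Context {R : realType} {n : nat}.
Variables (x : 'I_(2 * n) -> R) (o lam : R).

Definition strip (a w : R) (k : nat) : interval R :=
  `[a + k%:R * w, a + k.+1%:R * w[.

Lemma in_strip (a w : R) k y :
  (y \in strip a w k) = (a + k%:R * w <= y < a + k%:R * w + w).
Proof. by rewrite in_itv/= -natr1 mulrDl mul1r addrA. Qed.

(** The offset [lam] leaves cell 0 out, so that each block has neighbouring cells on both sides. A
    block of width 8 lam is filled by 2 m strips of width 4 lam / m. *)
Definition block_start (r : nat) : R := o + lam + r%:R * (8 * lam).

(* A treated i and a control j in two strips of the same block with index
   difference q, so that x i - x j is, up to the sign given by s, within one strip
   width of q strip widths. *)
Definition has_window (A : {set 'I_(2 * n)}) (m q r : nat) (s : bool) :=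
  exists i j c, [/\ i \in A, j \notin A, (c < m)%N,
    x i \in strip (block_start r) (4 * lam / m%:R) (c + if s then 0 else q)%N &
    x j \in strip (block_start r) (4 * lam / m%:R) (c + if s then q else 0)%N].

Hypothesis lam_gt0 : 0 < lam.

(* Cells 1, ..., 88 are grouped in 11 blocks of 8; 11 marks the outside.  At most
   8 blocks are touched before the last phase (2 by the coarse phase and by each
   of the three jumps) and that phase needs 3 untouched ones. *)
Definition block (i : 'I_(2 * n)) : nat :=
  if o + lam <= x i then Num.truncn ((x i - (o + lam)) / (8 * lam)) else 11%N.

Lemma blockP i (r : nat) : (r < 11)%N ->
  (block i == r) = (x i \in strip (o + lam) (8 * lam) r).
Proof.
move=> r11; have l8 : 0 < 8 * lam by rewrite mulr_gt0.
rewrite /block /strip in_itv/=; case: ifPn => [ge|]; last first.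
  rewrite -ltNge => lt; rewrite gtn_eqF//; apply/esym/negbTE.
  rewrite negb_and -ltNge (lt_le_trans lt)// lerDl mulr_ge0 ?ler0n//.
  exact: ltW.
have d0 : 0 <= (x i - (o + lam)) / (8 * lam).
  by rewrite divr_ge0 ?subr_ge0// ltW.
have -> : (o + lam + r%:R * (8 * lam) <= x i < o + lam + r.+1%:R * (8 * lam)) =
    (r%:R <= (x i - (o + lam)) / (8 * lam) < r.+1%:R).
  by rewrite ler_pdivlMr// ltr_pdivrMr// lerBrDl ltrBlDl.
by rewrite truncn_eq.
Qed.

Lemma block_mid i : (block i < 11)%N -> o + lam <= x i < o + 89 * lam.
Proof.
have l0 := lam_gt0.
move=> b11; have := blockP i b11; rewrite eqxx => /esym; rewrite in_itv/= => /andP[b1 b2].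
have : (0 : R) <= (block i)%:R by rewrite ler0n.
have : ((block i).+1%:R : R) <= 11 by rewrite ler_nat.
by move=> h1 h2; apply/andP; split; nra.
Qed.

Lemma block_in_cell i : (block i < 11)%N ->
  exists c, (c.+2 < 90)%N /\ in_cell x o lam c.+1 i.
Proof.
move=> /block_mid /andP[b1 b2]; have l0 := lam_gt0.
have d0 : 0 <= (x i - (o + lam)) / lam.
  by rewrite divr_ge0 ?subr_ge0// ltW.
have /andP[t1 t2] := truncn_itv d0.
set c := Num.truncn _ in t1 t2; exists c.
rewrite ler_pdivlMr// in t1; rewrite ltr_pdivrMr// -natr1 in t2.
split.
  rewrite -(ltr_nat R) -!natr1.
  have : c%:R * lam < 88 * lam by lra.
  by rewrite ltr_pM2r//; lra.
by rewrite /in_cell -!natr1; apply/andP; split; lra.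
Qed.

Lemma strip_block (m k r : nat) i : (0 < m)%N -> (r < 11)%N -> (k < 2 * m)%N ->
  x i \in strip (block_start r) (4 * lam / m%:R) k -> block i = r.
Proof.
move=> m0 r11 km xi; apply/eqP; rewrite blockP//; move: xi.
have w0 : 0 < 4 * lam / m%:R by rewrite divr_gt0 ?mulr_gt0 ?ltr0n.
have mw : m%:R * (4 * lam / m%:R) = 4 * lam.
  by rewrite mulrC divfK// pnatr_eq0 -lt0n.
set w := 4 * lam / m%:R in w0 mw *.
rewrite /block_start !in_itv/= -!natr1 => /andP[x1 x2].
have k1 : (0 : R) <= k%:R by rewrite ler0n.
have k2 : k%:R + 1 <= 2 * (m%:R : R).
  by rewrite natr1 -natrM ler_nat.
by apply/andP; split; nra.
Qed.

(** Strips at index distance 3 give differences strictly between 2 and 4 strip widths, and [tau k]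
    is 4 strip widths; hence the 3. *)
Lemma has_window_alive (tau : nat -> R) (A : {set 'I_(2 * n)}) (m k : nat) (r : 'I_11) :
  (3 <= m)%N -> tau k = 16 * lam / m%:R -> (forall s, has_window A m 3 r s) ->
  alive x block tau k A r.
Proof.
move=> m3 tauE win; apply/aliveP => s.
have m0 : (0 < m)%N by apply: leq_trans m3.
have w0 : 0 < 4 * lam / m%:R by rewrite divr_gt0 ?mulr_gt0 ?ltr0n.
have [i [j [c [iA jA cm xi xj]]]] := win s.
have [off1 off2] := window_offset s cm m3.
exists i, j; rewrite iA jA (strip_block m0 _ off1 xi)// (strip_block m0 _ off2 xj)//.
split=> //; rewrite tauE; move: xi xj; rewrite !in_strip.
rewrite (_ : 16 * lam / m%:R = 4 * (4 * lam / m%:R)); last by rewrite !mulrA -natrM.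
set w := 4 * lam / m%:R in w0 *; set a := block_start r.
case: (s); rewrite ?addn0 ?expr1 ?expr0 ?mulN1r ?mul1r !natrD
  => /andP[x1 x2] /andP[y1 y2]; apply/andP; split; lra.
Qed.

(** Rounding |u| down to a multiple q of the strip width costs one width, the positions within the
    strips another; hence an error of two widths. *)
Lemma has_window_windows (A : {set 'I_(2 * n)}) (m Q : nat) (U : R) :
  (0 < m)%N -> (Q <= m)%N -> U <= Q%:R * (4 * lam / m%:R) ->
  (forall q r s, (q <= Q)%N -> (r < 11)%N -> has_window A m q r s) ->
  windows (b := 11) x A block (8 * lam / m%:R) U.
Proof.
move=> m0 Qm UQ win r u uU.
have w0 : 0 < 4 * lam / m%:R by rewrite divr_gt0 ?mulr_gt0 ?ltr0n.
rewrite (_ : 8 * lam / m%:R = 2 * (4 * lam / m%:R)); last by rewrite !mulrA -natrM.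
set w := 4 * lam / m%:R in w0 UQ *.
have d0 : 0 <= `|u| / w by rewrite divr_ge0// ltW.
have /andP[t1 t2] := truncn_itv d0.
set q := Num.truncn _ in t1 t2.
rewrite ler_pdivlMr// in t1; rewrite ltr_pdivrMr// -natr1 in t2.
have qQ : (q <= Q)%N.
  rewrite -(ler_nat R) -(ler_pM2r w0); lra.
have [i [j [c [iA jA cm xi xj]]]] := win q r (u < 0) qQ (ltn_ord r).
have [off1 off2] := window_offset (u < 0) cm (leq_trans qQ Qm).
exists i, j; rewrite iA jA (strip_block m0 _ off1 xi)// (strip_block m0 _ off2 xj)//.
split=> //; move: xi xj; rewrite !in_strip -/w; set a := block_start r.
move: t1 t2; case: (ltP u 0) => u0; [rewrite ltr0_norm//|rewrite ger0_norm//];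
  rewrite /= ?addn0 !natrD => t1 t2 /andP[x1 x2] /andP[y1 y2];
  rewrite ler_norml; apply/andP; split; lra.
Qed.

(** The precision of each jump is the range of the next: [2 * m2 <= Q2 * m1] says that [Q2] strips
    of width 4 lam / m2 reach 8 lam / m1, half the imbalance left by the previous jump. The [m1]
    windows serve both the coarse phase and the first jump. *)
Lemma greedy_imbalance_bound (A0 B : allocation n) (K : R) (m1 m2 m3 Q2 Q3 J : nat) :
  (0 < n)%N -> 0 < stdev x -> greedy_run x A0 B ->
  (forall c, (c < 90)%N ->
     K < #|[set i in val A0 | x i \in strip o lam c]%SET|%:R) ->
  (forall c, (c < 90)%N ->
     K < #|[set i in ~: val A0 | x i \in strip o lam c]%SET|%:R) ->
  `|imbalance x (val A0)| <= lam * K ->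
  (16 <= m1)%N -> (0 < m2)%N -> (3 <= m3)%N ->
  (2 * m2 <= Q2 * m1)%N -> (2 * m3 <= Q3 * m2)%N -> (Q2 <= m2)%N -> (Q3 <= m3)%N ->
  (forall q r s, (q <= m1)%N -> (r < 11)%N -> has_window (val A0) m1 q r s) ->
  (forall q r s, (q <= Q2)%N -> (r < 11)%N -> has_window (val A0) m2 q r s) ->
  (forall q r s, (q <= Q3)%N -> (r < 11)%N -> has_window (val A0) m3 q r s) ->
  (forall k r s, (k <= J)%N -> (r < 11)%N -> has_window (val A0) (m3 * 2 ^ k) 3 r s) ->
  (forall i j l, o + lam <= x i < o + 89 * lam -> i != j -> i != l -> j != l ->
     `|x i - x j| <= 16 * lam / m3%:R -> `|x i - x l| <= 16 * lam / m3%:R -> False) ->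
  `|imbalance x (val B)| <= 16 * lam / (m3 * 2 ^ J)%:R.
Proof.
move=> n0 sd0 run manyT manyC small m1_16 m2_0 m3_3 mQ2 mQ3 Qm2 Qm3 win1 win2 win3 winJ trip.
have l0 := lam_gt0.
have m1R : (0 : R) < m1%:R by rewrite ltr0n; lia.
have m2R : (0 : R) < m2%:R by rewrite ltr0n; lia.
have m3R : (0 : R) < m3%:R by rewrite ltr0n; lia.
pose tau (k : nat) : R := 16 * lam / (m3 * 2 ^ k)%:R.
have tau0E : tau 0 = 2 * (8 * lam / m3%:R).
  by rewrite /tau expn0 muln1 !mulrA -natrM.
have W1 : windows (b := 11) x (val A0) block (8 * lam / m1%:R) (2 * lam).
  apply: (@has_window_windows _ m1 m1) => //; first by lia.
  by rewrite [leRHS]mulrC divfK ?gt_eqF//; lra.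
have W2 : windows (b := 11) x (val A0) block (8 * lam / m2%:R) (8 * lam / m1%:R).
  apply: (@has_window_windows _ m2 Q2) => //.
  rewrite mulrA ler_pdivlMr// mulrAC ler_pdivrMr//.
  have : (2 * m2)%:R <= (Q2 * m1)%:R :> R by rewrite ler_nat.
  by rewrite !natrM => h; nra.
have W3 : windows (b := 11) x (val A0) block (8 * lam / m3%:R) (8 * lam / m2%:R).
  apply: (@has_window_windows _ m3 Q3) => //; first by lia.
  rewrite mulrA ler_pdivlMr// mulrAC ler_pdivrMr//.
  have : (2 * m3)%:R <= (Q3 * m2)%:R :> R by rewrite ler_nat.
  by rewrite !natrM => h; nra.
have e1 : 8 * lam / m1%:R <= lam / 2.
  rewrite ler_pdivrMr//; have : (16 : R) <= m1%:R by rewrite ler_nat.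
  by nra.
have [A1 [run1 S1 u1]] := coarse n0 sd0 l0 manyT manyC block_in_cell small
  (erefl _) run e1 W1 (isT : 0 < 11)%N.
have [|A2 [run2 S2 u2]] := jump n0 sd0 run1 W1 (leq_ltn_trans u1 (isT : 2 < 11)%N).
  by lra.
have {}u2 := leq_trans u2 (leq_add u1 (leqnn 2)).
have [A3 [run3 S3 u3]] := jump n0 sd0 run2 W2 (leq_ltn_trans u2 (isT : 4 < 11)%N) S2.
have {}u3 := leq_trans u3 (leq_add u2 (leqnn 2)).
have [A4 [run4 S4 u4]] := jump n0 sd0 run3 W3 (leq_ltn_trans u3 (isT : 6 < 11)%N) S3.
have {}u4 := leq_trans u4 (leq_add u3 (leqnn 2)).
pose P : {set 'I_11} := (~: unclean (val A0) block (val A4))%SET.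
have P3 : (3 <= #|P|)%N.
  have := cardsC (unclean (b := 11) (val A0) block (val A4)).
  rewrite card_ord -/P => cP.
  by rewrite -(leq_add2l #|unclean (b := 11) (val A0) block (val A4)|) cP (leq_add u4
    (leqnn 3)).
have tau_gt0 k : 0 < tau k.
  by rewrite divr_gt0 ?mulr_gt0// ltr0n muln_gt0 expn_gt0 (ltnW (ltnW m3_3)).
have tau_half k : tau k = 2 * tau k.+1.
  by rewrite /tau expnS mulnCA [in RHS]natrM invfM [RHS]mulrCA mulVKf ?pnatr_eq0.
have trip' i j l : (block i < 11)%N -> i != j -> i != l -> j != l ->
    `|x i - x j| <= tau 0 -> `|x i - x l| <= tau 0 -> False.
  by move=> /block_mid; rewrite /tau expn0 muln1; exact: trip.
have inv4 : fine_inv x block tau J P (val A4).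
  split; first by rewrite tau0E.
  move=> k kJ; constructor 2; apply/eqP; rewrite cards_eq0; apply/eqP/setP => r.
  rewrite /dead inE finset.in_set0; apply/negbTE/andP => -[rP /negP]; apply.
  have /aliveP al : alive x block tau k (val A0) r.
    apply: (@has_window_alive tau (val A0) (m3 * 2 ^ k)) => //.
      by rewrite (leq_trans m3_3)// leq_pmulr// expn_gt0.
    by move=> s; apply: winJ.
  have rcl : r \notin unclean (val A0) block (val A4) by rewrite -finset.in_setC.
  apply/aliveP => s; have [u [v [uA vA lu lv uv]]] := al s.
  by exists u, v; rewrite (clean_mem rcl lu) (clean_mem rcl lv).
apply: (greedy_run_invariant n0 sd0 (Q := fine_inv x block tau J P)) run4 inv4.
- exact: fine_stop.
- by move=> A A' i j _ inv pick; right; exact: fine_step inv pick.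
Qed.

End GreedyBound.

(** * Second moments and measurability *)

Section IndicatorSums.
Context {d : measure_display} {Omega : measurableType d} {R : realType}.
Variable P : probability Omega R.

Definition pr (E : set Omega) : R := fine (P E).

Lemma prK E : measurable E -> (pr E)%:E = P E.
Proof. by move=> mE; rewrite fineK ?fin_num_measure. Qed.

Lemma pr_ge0 E : 0 <= pr E.
Proof. by rewrite fine_ge0. Qed.

Section Chebyshev.
Context {I : finType}.
Variables (E : I -> set Omega) (v : I -> R).
Hypothesis mE : forall a, measurable (E a).

Definition wsum (w : Omega) : R := \sum_a v a * \1_(E a) w.

Lemma measurable_wsum : measurable_fun setT wsum.
Proof.
rewrite /wsum; apply: measurable_sum => a.
by apply: measurable_funM => //; exact: measurable_indic.
Qed.

Lemma expectation_wsum : wsum \in Lfun P 1 /\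
  ('E_P[wsum] = (\sum_a v a * pr (E a))%:E)%E.
Proof.
have L1 a : \1_(E a) \in Lfun P 1.
  by apply/Lfun1_integrable; exact: integrable_indic.
have L2 a : (v a \o* \1_(E a)) \in Lfun P 1 by apply: Lfun_scale.
pose s := [seq v a \o* \1_(E a) | a <- enum I] : seq (Omega -> R).
have sE : wsum = \sum_(f <- s) f.
  apply/funext => w; rewrite /wsum /s big_map big_enum/= fct_sumE.
  by apply: eq_bigr => a _; rewrite /= mulrC.
have Ls f : f \in s -> f \in Lfun P 1 by move=> /mapP[a _ ->].
rewrite sE; split; first by rewrite big_seq rpred_sum.
rewrite expectation_sum// /s big_map big_enum/= -sumEFin.
by apply: eq_bigr => a _; rewrite expectationZl// expectation_indic// EFinM prK.
Qed.

End Chebyshev.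

Lemma chebyshev_wsum {I : finType} (E : I -> set Omega) (v : I -> R) (t : R) :
  (forall a, measurable (E a)) -> 0 < t ->
  (P [set w | (t <= `|wsum E v w - \sum_a v a * pr (E a)|)%R] <=
   ((\sum_a \sum_b v a * v b * (pr (E a `&` E b) - pr (E a) * pr (E b))) / t ^+ 2)%:E)%E.
Proof.
move=> mE t0; have [L1 EW] := expectation_wsum v mE.
pose W : {RV P >-> R} := HB.pack (wsum E v) (isMeasurableFun.Build _ _ _ _ (wsum E v)
  (measurable_wsum v mE)).
have := @chebyshev _ _ _ P W t t0.
have -> : ('E_P[W] = (\sum_a v a * pr (E a))%R%:E)%E by [].
move=> /le_trans; apply.
(* The square of a weighted sum of indicators is again such a sum, over pairs of indices, so
   [expectation_wsum] also gives the second moment. *)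
pose E2 (ab : I * I) := E ab.1 `&` E ab.2.
pose v2 (ab : I * I) := v ab.1 * v ab.2.
have mE2 ab : measurable (E2 ab) by apply: measurableI.
have [L2 EW2] := expectation_wsum v2 mE2.
set mu := \sum_a v a * pr (E a) in EW *.
rewrite muleC EFinM; apply: lee_pmul => //.
- exact: variance_ge0.
- by rewrite lee_fin invr_ge0 exprn_ge0// ltW.
rewrite /variance covariance.unlock EW/=.
have -> : ((wsum E v \- cst mu) * (wsum E v \- cst mu)) =
    (wsum E2 v2 \- (2 * mu) \o* wsum E v) \+ cst (mu ^+ 2).
  apply/funext => w /=.
  have -> : wsum E2 v2 w = wsum E v w * wsum E v w.
    rewrite /wsum big_distrlr/=.
    rewrite pair_bigA/=; apply: eq_bigr => -[a b] _ /=.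
    by rewrite /v2 /E2 /= indicI/= mulrACA.
  transitivity ((wsum E v w - mu) * (wsum E v w - mu)) => //; ring.
rewrite expectationD ?expectationB ?expectationZl ?Lfun_scale ?rpredB ?Lfun_cst ?Lfun_scale//.
rewrite EW EW2 expectation_cst -EFinM -EFinB -EFinD lee_fin.
under [leRHS]eq_bigr => a _.
  under eq_bigr => b _ do rewrite mulrBr mulrACA.
  rewrite sumrB; over.
rewrite sumrB /= pair_bigA/=.
under [X in _ <= _ - X]eq_bigr => a _ do rewrite -mulr_sumr.
rewrite -mulr_suml -/mu /v2 /E2 /=.
by rewrite lerBrDr; lra.
Qed.

End IndicatorSums.

Section MeasurableConditions.
Context {R : realType} {T : Type}.
Implicit Types (Q : (T -> R) -> Prop) (g : (T -> R) -> R).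

(* Quantifying over all measurable spaces lets the same proof give measurability
   in Omega and in the sigma-algebra generated by the covariates. *)
Definition measurable_condition Q := forall (d : measure_display)
  (Omega : measurableType d) (Y : T -> Omega -> R),
  (forall i, measurable_fun setT (Y i)) -> measurable [set w | Q (Y ^~ w)].

Definition measurable_statistic g := forall (d : measure_display)
  (Omega : measurableType d) (Y : T -> Omega -> R),
  (forall i, measurable_fun setT (Y i)) -> measurable_fun setT (fun w => g (Y ^~ w)).

Lemma measurable_condition_cst (p : Prop) : measurable_condition (fun=> p).
Proof.
move=> d Omega Y mY; have [hp|np] := pselect p.
  by rewrite (_ : mkset _ = setT)//; apply/seteqP; split.
by rewrite (_ : mkset _ = set0)//; apply/seteqP; split.
Qed.

Lemma measurable_conditionN Q : measurable_condition Q ->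
  measurable_condition (fun x => ~ Q x).
Proof. by move=> mQ d Omega Y mY; exact: measurableC (mQ _ _ _ mY). Qed.

Lemma measurable_condition_and Q1 Q2 : measurable_condition Q1 ->
  measurable_condition Q2 -> measurable_condition (fun x => Q1 x /\ Q2 x).
Proof.
by move=> m1 m2 d Omega Y mY; exact: measurableI (m1 _ _ _ mY) (m2 _ _ _ mY).
Qed.

Lemma measurable_condition_and5 Q1 Q2 Q3 Q4 Q5 : measurable_condition Q1 ->
  measurable_condition Q2 -> measurable_condition Q3 -> measurable_condition Q4 ->
  measurable_condition Q5 ->
  measurable_condition (fun x => [/\ Q1 x, Q2 x, Q3 x, Q4 x & Q5 x]).
Proof.
move=> m1 m2 m3 m4 m5 d Omega Y mY.
have m := measurable_condition_and m1 (measurable_condition_and m2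
  (measurable_condition_and m3 (measurable_condition_and m4 m5))).
have := m _ _ _ mY; congr measurable; apply/seteqP; split => w /= [];
  by [move=> ? [? [? [? ?]]]; split|split].
Qed.

Lemma measurable_condition_or Q1 Q2 : measurable_condition Q1 ->
  measurable_condition Q2 -> measurable_condition (fun x => Q1 x \/ Q2 x).
Proof.
by move=> m1 m2 d Omega Y mY; exact: measurableU (m1 _ _ _ mY) (m2 _ _ _ mY).
Qed.

Lemma measurable_condition_ex (I : countType) (Q : I -> (T -> R) -> Prop) :
  (forall i, measurable_condition (Q i)) ->
  measurable_condition (fun x => exists i, Q i x).
Proof.
move=> mQ d Omega Y mY.
have -> : [set w | exists i, Q i (Y ^~ w)] = \bigcup_i [set w | Q i (Y ^~ w)].
  by apply/seteqP; split => w /= [i]; [exists i|exists i].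
apply: countable_bigcupT_measurable; first exact: countableP.
by move=> i; exact: mQ.
Qed.

Lemma measurable_condition_stat g (B : set R) : measurable_statistic g ->
  measurable B -> measurable_condition (fun x => B (g x)).
Proof.
move=> mg mB d Omega Y mY; have := mg _ _ _ mY measurableT B mB.
by rewrite setTI.
Qed.

Lemma measurable_statistic_coord i : measurable_statistic (fun x => x i).
Proof. by move=> d Omega Y mY; exact: mY. Qed.

Lemma measurable_condition_coord i (B : set R) : measurable B ->
  measurable_condition (fun x => B (x i)).
Proof. exact/measurable_condition_stat/measurable_statistic_coord. Qed.

End MeasurableConditions.

(** * Windows without pairs *)

Lemma sum_indR {R : realType} {T : finType} (Q : pred T) :
  \sum_i (Q i)%:R = #|Q|%:R :> R.
Proof.
rewrite -sum1_card natr_sum [RHS]big_mkcond.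
by apply: eq_bigr => i _; rewrite -topredE /=; case: (Q i).
Qed.

Lemma sum_delta {R : realType} {T : finType} (c : T) (g : T -> R) :
  \sum_k (k == c)%:R * g k = g c.
Proof.
rewrite (bigD1 c)//= eqxx mul1r big1 ?addr0// => k /negPf ->.
by rewrite mul0r.
Qed.

Section Independence.
Context {d : measure_display} {Omega : measurableType d} {R : realType}.
Variable P : probability Omega R.
Context {T : finType}.
Variable X : T -> {RV P >-> R}.
Hypothesis indep : mutually_independent P X.

Local Notation ev i B := (X i @^-1` B : set Omega).

Lemma measurable_ev i B : measurable B -> measurable (ev i B).
Proof. by move=> mB; rewrite -[X in measurable X]setTI; exact: measurable_funP. Qed.

Lemma pr_bigI (s : seq T) (B : T -> set R) : uniq s -> (forall i, measurable (B i)) ->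
  pr P (\big[setI/setT]_(i <- s) ev i (B i)) = \prod_(i <- s) pr P (ev i (B i)).
Proof.
move=> us mB; apply: EFin_inj; rewrite prK; last first.
  by apply: bigsetI_measurable => i _; exact: measurable_ev.
rewrite -(bigcap_seq s (fun i => ev i (B i))).
have := indep [set i in s]%SET mB.
rewrite (_ : [set` [set i in s]%SET] = [set` s]); last first.
  by apply/seteqP; split => i /=; rewrite inE.
move=> ->.
rewrite (eq_bigl (mem s)); last by move=> i; rewrite inE.
rewrite -big_uniq//= -[RHS]prodEFin.
by apply: eq_bigr => i _; rewrite prK//; exact: measurable_ev.
Qed.


Lemma pr_ev2 i j A B : i != j -> measurable A -> measurable B ->
  pr P (ev i A `&` ev j B) = pr P (ev i A) * pr P (ev j B).
Proof.
move=> ij mA mB; pose C k := if k == i then A else B.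
have := @pr_bigI [:: i; j] C; rewrite /= !inE ij !big_cons !big_nil setIT mulr1.
rewrite /C eqxx eq_sym (negPf ij) => -> //.
by move=> k; case: ifP.
Qed.

Lemma pr_ev3 i j k A B C : uniq [:: i; j; k] ->
  measurable A -> measurable B -> measurable C ->
  pr P (ev i A `&` (ev j B `&` ev k C)) = pr P (ev i A) * (pr P (ev j B) * pr P (ev k C)).
Proof.
move=> u mA mB mC; pose D l := if l == i then A else if l == j then B else C.
have := @pr_bigI _ D u; rewrite !big_cons !big_nil setIT mulr1.
move: u; rewrite /= !inE negb_or andbT => /andP[/andP[ij ik] jk].
rewrite /D !eqxx (eq_sym j) (negPf ij) (eq_sym k i) (negPf ik) (eq_sym k j) (negPf jk) =>
  -> //.
by move=> l; do 2?case: ifP.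
Qed.

Lemma pr_ev4 i j k l A B C D : uniq [:: i; j; k; l] ->
  measurable A -> measurable B -> measurable C -> measurable D ->
  pr P ((ev i A `&` ev j B) `&` (ev k C `&` ev l D)) =
  pr P (ev i A `&` ev j B) * pr P (ev k C `&` ev l D).
Proof.
move=> u mA mB mC mD.
pose E m := if m == i then A else if m == j then B else if m == k then C else D.
have := @pr_bigI _ E u; rewrite !big_cons !big_nil setIT mulr1.
move: u; rewrite /= !inE !negb_or andbT => /and3P[/and3P[ij ik il] /andP[jk jl] kl].
rewrite (pr_ev2 ij)// (pr_ev2 kl)//.
rewrite /E !eqxx (eq_sym j i) (negPf ij) (eq_sym k i) (negPf ik) (eq_sym k j) (negPf jk).
rewrite (eq_sym l i) (negPf il) (eq_sym l j) (negPf jl) (eq_sym l k) (negPf kl) => H.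
rewrite -setIA H ?mulrA// => m; by do 3?case: ifP.
Qed.

Lemma le_pr (A B : set Omega) : measurable A -> measurable B -> A `<=` B ->
  pr P A <= pr P B.
Proof.
by move=> mA mB AB; rewrite fine_le ?fin_num_measure// le_measure ?inE.
Qed.

Section Window.
Variables (A : {set T}) (n m : nat) (U L : nat -> set R) (al be : R).
Hypotheses (cA : #|A| = n) (cA' : #|~: A| = n).
Hypotheses (mU : forall c, measurable (U c)) (mL : forall c, measurable (L c)).
Hypothesis dU : forall c c', c != c' -> U c `&` U c' = set0.
Hypothesis dL : forall c c', c != c' -> L c `&` L c' = set0.
Hypothesis al_gt0 : 0 < al.
Hypothesis prU : forall i c, (c < m)%N -> al <= pr P (ev i (U c)) <= be.
Hypothesis prL : forall i c, (c < m)%N -> al <= pr P (ev i (L c)) <= be.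

Let E (a : (T * T) * 'I_m) : set Omega := ev a.1.1 (U a.2) `&` ev a.1.2 (L a.2).
Let v (a : (T * T) * 'I_m) : R := ((a.1.1 \in A) && (a.1.2 \notin A))%:R.

Let mE a : measurable (E a).
Proof. by apply: measurableI; exact: measurable_ev. Qed.

(* Only pairs of pairs sharing an individual, and lying in the same window, are
   positively correlated. *)
Let bound (a b : (T * T) * 'I_m) : R :=
  (a.2 == b.2)%:R * ((a.1.1 == b.1.1)%:R * (a.1.2 == b.1.2)%:R * be ^+ 2 +
   (a.1.1 == b.1.1)%:R * be ^+ 3 + (a.1.2 == b.1.2)%:R * be ^+ 3).

Let be_ge0 (c : 'I_m) (i : T) : 0 <= be.
Proof. by have /andP[h1 h2] := prU i (ltn_ord c); have := al_gt0; lra. Qed.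

Let cov_le a b : v a * v b * (pr P (E a `&` E b) - pr P (E a) * pr P (E b)) <=
  v a * v b * bound a b.
Proof.
case: a b => [[i j] c] [[i' j'] c']; rewrite /v /=.
have [/andP[iA jA]|_] := boolP (_ && _); last by rewrite !mul0r.
have [/andP[iA' jA']|_] := boolP ((i' \in A) && (j' \notin A)); last by rewrite mulr0 !mul0r.
rewrite !mul1r.
have AN k l : k \in A -> l \notin A -> k != l by move=> kA; apply: contraNneq => <-.
have ij := AN _ _ iA jA; have ij' := AN _ _ iA jA'.
have i'j := AN _ _ iA' jA; have i'j' := AN _ _ iA' jA'.
have b0 := be_ge0 c i.
have b2 : 0 <= be ^+ 2 by rewrite exprn_ge0.
have b3 : 0 <= be ^+ 3 by rewrite exprn_ge0.
have pp : 0 <= pr P (E (i, j, c)) * pr P (E (i', j', c')) by rewrite mulr_ge0// pr_ge0.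
have [iU jL] := (prU i (ltn_ord c), prL j (ltn_ord c)).
have jL' := prL j' (ltn_ord c).
have iU' := prU i' (ltn_ord c).
have bd0 : 0 <= bound (i, j, c) (i', j', c').
  by rewrite /bound !mulr_ge0 ?ler0n ?addr_ge0 ?mulr_ge0 ?ler0n.
have [/andP[Ni Nj]|] := boolP ((i != i') && (j != j')).
  rewrite /E /= pr_ev4 ?subrr//=.
  by rewrite !inE !negb_or Ni ij ij' (eq_sym j i') i'j Nj i'j'.
rewrite negb_and !negbK => same.
(* In different windows, a shared individual would lie in two disjoint sets, so the covariance is at
   most 0. *)
have [cc'|cc'] := eqVneq c c'; last first.
  suff -> : E (i, j, c) `&` E (i', j', c') = set0.
    by rewrite /pr measure0 /= sub0r; apply: le_trans bd0; rewrite oppr_le0.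
  rewrite /E /=; apply/seteqP; split => // w [[w1 w2] [w3 w4]].
  case/orP: same => /eqP e; [rewrite -e in w3|rewrite -e in w4].
    by have : (U c `&` U c') (X i w) by []; rewrite dU.
  by have : (L c `&` L c') (X j w) by []; rewrite dL.
subst c'; rewrite /bound /= eqxx mul1r.
apply: (le_trans (y := pr P (E (i, j, c) `&` E (i', j', c)))); first by rewrite gerBl.
have [ei|Ni] := eqVneq i i'; have [ej|Nj] := eqVneq j j'.
- subst i' j'; rewrite setIid /E /= pr_ev2// !mul1r -addrA.
  apply: ler_wpDr; first by rewrite addr_ge0.
  by rewrite expr2 ler_pM ?pr_ge0//; [case/andP: iU|case/andP: jL].
- subst i'; rewrite mulr0 !mul0r add0r addr0 mul1r.
  apply: (le_trans (y := pr P (ev i (U c) `&` (ev j (L c) `&` ev j' (L c))))).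
    apply: le_pr.
    + exact: measurableI.
    + by apply: measurableI; [|apply: measurableI]; exact: measurable_ev.
    + by move=> w [[? ?] [? ?]].
  rewrite pr_ev3//; last by rewrite /= !inE negb_or ij ij' Nj.
  rewrite !exprS expr0 mulr1 ler_pM ?mulr_ge0 ?pr_ge0//; first by case/andP: iU.
  by rewrite ler_pM ?pr_ge0//; [case/andP: jL|case/andP: jL'].
- subst j'; rewrite !mul0r !add0r mul1r.
  apply: (le_trans (y := pr P (ev i (U c) `&` (ev i' (U c) `&` ev j (L c))))).
    apply: le_pr.
    + exact: measurableI.
    + by apply: measurableI; [|apply: measurableI]; exact: measurable_ev.
    + by move=> w [[? ?] [? ?]].
  rewrite pr_ev3//; last by rewrite /= !inE negb_or Ni ij i'j.
  rewrite !exprS expr0 mulr1 ler_pM ?mulr_ge0 ?pr_ge0//; first by case/andP: iU.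
  by rewrite ler_pM ?pr_ge0//; [case/andP: iU'|case/andP: jL].
- by exfalso; move: same; rewrite (negPf Ni) (negPf Nj).
Qed.

Let sum_v : \sum_a v a = n%:R ^+ 2 * m%:R.
Proof.
rewrite -(pair_bigA _ (fun p c => v (p, c)))/=.
rewrite (eq_bigr (fun p : T * T => ((p.1 \in A) && (p.2 \notin A))%:R * m%:R)); last first.
  by move=> p _; rewrite /v/= sumr_const card_ord mulr_natr.
rewrite -mulr_suml; congr (_ * _).
rewrite -(pair_bigA _ (fun i j => ((i \in A) && (j \notin A))%:R))/=.
rewrite (eq_bigr (fun i => (i \in A)%:R * n%:R)).
  by rewrite -mulr_suml sum_indR cA expr2.
move=> i _; under eq_bigr do rewrite -mulnb natrM.
rewrite -mulr_sumr sum_indR -cA'; congr (_ * _%:R); apply: eq_card => j.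
by rewrite !inE.
Qed.

Let sum_bound a : \sum_b v a * v b * bound a b <= v a * (be ^+ 2 + 2 * n%:R * be ^+ 3).
Proof.
case: a => [[i j] c]; have b0 := be_ge0 c i.
have b2 : 0 <= be ^+ 2 by rewrite exprn_ge0.
have b3 : 0 <= be ^+ 3 by rewrite exprn_ge0.
under eq_bigr do rewrite -mulrA.
rewrite -mulr_sumr; apply: ler_wpM2l; first by rewrite ler0n.
pose g (b : (T * T) * 'I_m) : R := (b.2 == c)%:R * ((b.1.1 == i)%:R * ((b.1.2 == j)%:R *
  be ^+ 2) +
   (b.1.1 == i)%:R * ((b.1.2 \in ~: A)%:R * be ^+ 3) +
     (b.1.2 == j)%:R * ((b.1.1 \in A)%:R * be ^+ 3)).
apply: (le_trans (y := \sum_b g b)).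
  apply: ler_sum => -[[i' j'] c'] _; rewrite /g /v /bound /= !inE.
  rewrite (eq_sym c c') (eq_sym i i') (eq_sym j j') mulrCA ler_wpM2l ?ler0n//.
  case: (i' \in A); case: (j' \notin A) => /=;
    rewrite ?mul1r ?mul0r ?mulr0 ?mulrA ?addr0 ?add0r //;
  by rewrite ?addr_ge0// ?mulr_ge0 ?ler0n.
rewrite -(pair_bigA _ (fun p c => g (p, c)))/=.
under eq_bigr do rewrite /g /= sum_delta.
rewrite -(pair_bigA _ (fun k l => (k == i)%:R * ((l == j)%:R * be ^+ 2) +
  (k == i)%:R * ((l \in ~: A)%:R * be ^+ 3) + (l == j)%:R * ((k \in A)%:R * be ^+ 3)))/=.
under eq_bigr => k _.
  rewrite !big_split/= -!mulr_sumr !sum_delta -mulr_suml sum_indR.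
  rewrite cA'.
  over.
rewrite !big_split/= !sum_delta -mulr_suml sum_indR cA.
by lra.
Qed.

(** Without a pair the count is 0 although its mean is at least [t]. For [al] and [be] of order 1 /
    m, Chebyshev's inequality gives order m / n^2 + 1 / n: the first term comes from each pair with
    itself, the second from pairs sharing one individual. *)
Lemma prob_no_pair_in_windows : (0 < n)%N -> (0 < m)%N ->
  (P [set w | ~ exists i j c, [/\ i \in A, j \notin A, (c < m)%N,
                                  U c (X i w) & L c (X j w)]]
   <= ((be ^+ 2 + 2 * n%:R * be ^+ 3) / (n%:R ^+ 2 * m%:R * al ^+ 4))%:E)%E.
Proof.
move=> n0 m0.
have n0R : (0 : R) < n%:R by rewrite ltr0n.
have m0R : (0 : R) < m%:R by rewrite ltr0n.
pose t : R := n%:R ^+ 2 * m%:R * al ^+ 2.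
have t0 : 0 < t by rewrite !mulr_gt0// exprn_gt0.
have tmu : t <= \sum_a v a * pr P (E a).
  rewrite /t -sum_v mulr_suml; apply: ler_sum => -[[i j] c] _; rewrite {1}/v /v /=.
  have [/andP[iA jA]|_] := boolP (_ && _); last by rewrite !mul0r.
  rewrite !mul1r /E /= pr_ev2//; last by apply: contraNneq jA => <-.
  have /andP[h1 _] := prU i (ltn_ord c); have /andP[h2 _] := prL j (ltn_ord c).
  by rewrite expr2 ler_pM// ltW.
apply: (le_trans (y := P [set w | (t <= `|wsum E v w - \sum_a v a * pr P (E a)|)%R])).
  apply: le_measure; rewrite ?inE.
  - apply: (measurable_conditionN (Q := fun x => exists i j c, [/\ i \in A, j \notin A,
        (c < m)%N, U c (x i) & L c (x j)])) => //.
    do 3![apply: measurable_condition_ex => ?].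
    apply: measurable_condition_and5;
      by [exact: measurable_condition_cst|exact: measurable_condition_coord].
  - have mW := measurable_wsum v mE.
    have := measurable_funB mW (measurable_cst (\sum_a v a * pr P (E a))).
    move=> /(measurableT_comp (@normr_measurable _ _)) /(_ measurableT `[t,
      +oo[%classic (measurable_itv _)).
    by rewrite setTI; congr measurable; apply/seteqP; split => w /=; rewrite in_itv/= andbT.
  - move=> w /= none; suff -> : wsum E v w =
    0 by rewrite sub0r normrN (le_trans tmu)// ler_norm.
    rewrite /wsum big1// => -[[i j] c] _; rewrite /v /=.
    have [/andP[iA jA]|_] := boolP (_ && _); last by rewrite mul0r.
    rewrite indicE memNset ?mulr0// => -[/= w1 w2]; apply: none.
    by exists i, j, c.
apply: (le_trans (chebyshev_wsum P v mE t0)); rewrite lee_fin.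
rewrite ler_pdivrMr ?exprn_gt0//.
have -> : (be ^+ 2 + 2 * n%:R * be ^+ 3) / (n%:R ^+ 2 * m%:R * al ^+ 4) * t ^+ 2 =
    n%:R ^+ 2 * m%:R * (be ^+ 2 + 2 * n%:R * be ^+ 3).
  by rewrite /t; field; rewrite ?gt_eqF.
apply: (le_trans (y := \sum_a \sum_b v a * v b * bound a b)).
  by apply: ler_sum => a _; apply: ler_sum => b _; exact: cov_le.
rewrite -sum_v mulr_suml; apply: ler_sum => a _; exact: sum_bound.
Qed.

End Window.

End Independence.

(** * Counts and step sums *)

Section IndependentSums.
Context {d : measure_display} {Omega : measurableType d} {R : realType}.
Variable P : probability Omega R.
Context {T : finType}.
Variable X : T -> {RV P >-> R}.
Hypothesis indep : mutually_independent P X.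

Local Notation ev i B := (X i @^-1` B : set Omega).

Lemma pr_le1 (E : set Omega) : measurable E -> pr P E <= 1.
Proof. by move=> mE; rewrite -lee_fin prK//; exact: probability_le1. Qed.

(** Only indices with the same individual are correlated, each contributing at most L^2. The crude
    factor m^2 is harmless, as m will not depend on the number of individuals. *)
Lemma step_sum_deviation (m : nat) (B : 'I_m -> set R) (v : T -> 'I_m -> R) (L t : R) :
  (forall k, measurable (B k)) -> (forall i k, `|v i k| <= L) -> 0 < t ->
  (P [set w | (t <= `|\sum_i \sum_k v i k * \1_(B k) (X i w) -
                      \sum_i \sum_k v i k * pr P (ev i (B k))|)%R] <=
   ((#|T|%:R * m%:R ^+ 2 * L ^+ 2) / t ^+ 2)%:E)%E.
Proof.
move=> mB vL t0.
pose E (a : T * 'I_m) := ev a.1 (B a.2).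
pose u (a : T * 'I_m) := v a.1 a.2.
have mE a : measurable (E a) by exact: measurable_ev.
have := chebyshev_wsum P u mE t0.
have -> : \sum_a u a * pr P (E a) = \sum_i \sum_k v i k * pr P (ev i (B k)).
  by rewrite pair_bigA.
have -> : wsum E u = fun w => \sum_i \sum_k v i k * \1_(B k) (X i w).
  by apply/funext => w; rewrite /wsum pair_bigA.
move=> /le_trans; apply; rewrite lee_fin; apply: ler_wpM2r.
  by rewrite invr_ge0 exprn_ge0// ltW.
pose c (a b : T * 'I_m) : R := (b.1 == a.1)%:R * L ^+ 2.
apply: (le_trans (y := \sum_a \sum_b c a b)).
  apply: ler_sum => a _; apply: ler_sum => b _; rewrite /c.
  have [e|Nab] := eqVneq b.1 a.1; last first.
    by rewrite /E pr_ev2// ?subrr ?mulr0 ?mul0r// eq_sym.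
  rewrite mul1r; apply: le_trans (ler_norm _) _; rewrite normrM -[leRHS]mulr1.
  have pE a' : 0 <= pr P (E a') <= 1 by rewrite pr_ge0 pr_le1.
  have pI : 0 <= pr P (E a `&` E b) <= 1.
    by rewrite pr_ge0 pr_le1//; exact: measurableI.
  apply: ler_pM => //; first by rewrite normrM expr2 ler_pM// /u.
  have /andP[a0 a1] := pE a; have /andP[b0 b1] := pE b; have /andP[i0 i1] := pI.
  have ab0 := mulr_ge0 a0 b0.
  have ab1 : pr P (E a) * pr P (E b) <= 1 by rewrite mulr_ile1.
  by rewrite ler_norml; apply/andP; split; lra.
rewrite -(pair_bigA _ (fun i k => \sum_b c (i, k) b))/=.
have S i k : \sum_b c (i, k) b = m%:R * L ^+ 2.
  rewrite -(pair_bigA _ (fun j l => c (i, k) (j, l)))/= /c/=.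
  under eq_bigr do rewrite sumr_const card_ord -[_ *+ m]mulr_natr -mulrA.
  by rewrite sum_delta mulrC.
under eq_bigr do under eq_bigr do rewrite S.
under eq_bigr do rewrite sumr_const card_ord.
rewrite sumr_const -[_ *+ #|T|]mulr_natr -[_ *+ m]mulr_natr.
by rewrite le_eqVlt; apply/orP; left; apply/eqP; ring.
Qed.

Lemma measurable_statistic_step (m : nat) (B : 'I_m -> set R) (v : T -> 'I_m -> R) :
  (forall k, measurable (B k)) ->
  measurable_statistic (fun x : T -> R => \sum_i \sum_k v i k * \1_(B k) (x i)).
Proof.
move=> mB d' Omega' Y mY; apply: measurable_sum => i; apply: measurable_sum => k.
apply: measurable_funM => //.
have mI : measurable_fun setT (\1_(B k) : R -> R) by exact: measurable_indic.
exact: (measurableT_comp mI (mY i)).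
Qed.

Lemma measurable_condition_ge_dist (g : (T -> R) -> R) (c t : R) :
  measurable_statistic g -> measurable_condition (fun x => t <= `|g x - c|).
Proof.
move=> mg d' Omega' Y mY.
have := measurable_funB (mg _ _ _ mY) (measurable_cst c).
move=> /(measurableT_comp (@normr_measurable _ _)) /(_ measurableT `[t,
  +oo[%classic (measurable_itv _)).
by rewrite setTI; congr measurable; apply/seteqP; split => w /=; rewrite in_itv/= andbT.
Qed.

Lemma card_in_step (A : {set T}) (b : interval R) (x : T -> R) :
  #|[set i in A | x i \in b]%SET|%:R =
  \sum_i \sum_(k < 1) (i \in A)%:R * \1_([set` b]) (x i) :> R.
Proof.
rewrite -sum1_card natr_sum [LHS]big_mkcond; apply: eq_bigr => i _.
rewrite big_ord1 inE indicE; case: (i \in A) => /=; last by rewrite mul0r.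
by rewrite mul1r mem_setE; case: (_ \in b).
Qed.

Lemma measurable_condition_count (A : {set T}) (b : interval R) (K : R) :
  measurable_condition (fun x : T -> R => K < #|[set i in A | x i \in b]%SET|%:R).
Proof.
have m := @measurable_statistic_step 1 (fun=> [set` b]) (fun i _ =>
  (i \in A)%:R) (fun=> measurable_itv b).
move=> d' Omega' Y mY.
have := measurable_condition_stat m (measurable_itv `]K, +oo[) mY.
by congr measurable; apply/seteqP; split => w /=; rewrite in_itv/= andbT card_in_step.
Qed.

Lemma prob_few_in_interval (A : {set T}) (n : nat) (b : interval R) (al : R) :
  #|T| = (2 * n)%N -> #|A| = n -> (0 < n)%N -> 0 < al ->
  (forall i, al <= pr P (ev i [set` b])) ->
  (P [set w | ~ (n%:R * al / 2 < #|[set i in A | X i w \in b]%SET|%:R)%R] <=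
   (8 / (n%:R * al ^+ 2))%:E)%E.
Proof.
move=> cT cA n0 al0 lo; have n0R : (0 : R) < n%:R by rewrite ltr0n.
have t0 : 0 < n%:R * al / 2 by rewrite divr_gt0// mulr_gt0.
pose v (i : T) (k : 'I_1) : R := (i \in A)%:R.
have v1 i k : `|v i k| <= 1 by rewrite /v; case: (_ \in _); rewrite ?normr0 ?normr1 ?ler01.
have mb : forall k : 'I_1, measurable ((fun=> [set` b]) k : set R) by move=> k;
  exact: measurable_itv.
have := step_sum_deviation mb v1 t0.
set S := [set w | _]; move=> H.
apply: (@le_trans _ _ (P S)); last first.
  apply: le_trans H _; rewrite lee_fin cT natrM le_eqVlt; apply/orP; left.
  by apply/eqP; field; rewrite !gt_eqF.
have meanE : n%:R * al <= \sum_i \sum_(k < 1) v i k * pr P (ev i [set` b]).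
  rewrite -cA -sum_indR mulr_suml; apply: ler_sum => i _; rewrite big_ord1 /v.
  by rewrite ler_wpM2l ?ler0n//.
apply: le_measure; rewrite ?inE.
- apply: (measurable_conditionN (Q := fun x :
  T -> R => n%:R * al / 2 < #|[set i in A | x i \in b]%SET|%:R)) => //.
  exact: measurable_condition_count.
- apply: (measurable_condition_ge_dist _ _ (measurable_statistic_step v mb)) => i.
  exact: measurable_funP.
- move=> w /= /negP; rewrite -leNgt card_in_step => le.
  by rewrite /S /= distrC; apply: le_trans (ler_norm _); lra.
Qed.

End IndependentSums.

(** * The initial imbalance *)

Section StepApproximation.
Context {R : realType}.

Definition step_value (L : R) (m k : nat) : R := - L + k%:R * (2 * L / m%:R).

(** Between c - L and c + L the sum is t - c rounded down by less than a strip; outside it is 0 and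
    |t - c| <= (t - c)^2 / L. Independence is given for events, so the law of large numbers is run
    on step functions, and the finite variance controls the quadratic error. *)
Lemma step_approx (c L t : R) (m : nat) : 0 < L -> (0 < m)%N ->
  `|t - c - \sum_(k < m) step_value L m k * \1_([set` strip (c - L) (2 * L / m%:R) k]) t|
    <= 2 * L / m%:R + (t - c) ^+ 2 / L.
Proof.
move=> L0 m0; have m0R : (0 : R) < m%:R by rewrite ltr0n.
have w0 : 0 < 2 * L / m%:R by rewrite divr_gt0// mulr_gt0.
have mw : m%:R * (2 * L / m%:R) = 2 * L by rewrite mulrC divfK// gt_eqF.
rewrite /step_value; set w := 2 * L / m%:R in w0 mw *.
have q0 : 0 <= (t - c) ^+ 2 / L by rewrite divr_ge0 ?sqr_ge0// ltW.
have [/andP[t1 t2]|out] := boolP (c - L <= t < c + L).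
  have d0 : 0 <= (t - (c - L)) / w by rewrite divr_ge0 ?subr_ge0// ltW.
  have /andP[k1 k2] := truncn_itv d0.
  set k := Num.truncn _ in k1 k2.
  have km : (k < m)%N.
    rewrite -(ltr_nat R); apply: le_lt_trans k1 _.
    by rewrite ltr_pdivrMr// mw; lra.
  have inE' (j : nat) : (t \in strip (c - L) w j) = (j == k).
    rewrite in_itv/=.
    have -> : (c - L + j%:R * w <= t < c - L + j.+1%:R * w) =
        (j%:R <= (t - (c - L)) / w < j.+1%:R).
      by rewrite ler_pdivlMr// ltr_pdivrMr// lerBrDl ltrBlDl.
    by rewrite -truncn_eq// eq_sym.
  rewrite (bigD1 (Ordinal km))//= big1 ?addr0; last first.
    move=> j /negPf jk; rewrite indicE mem_setE inE'.
    by rewrite (_ : (j == k :> nat) = false) ?mulr0// -jk.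
  rewrite indicE mem_setE inE' eqxx mulr1.
  rewrite ler_pdivlMr// in k1; rewrite ltr_pdivrMr// -natr1 in k2.
  by rewrite ler_norml; apply/andP; split; lra.
rewrite big1 ?subr0; last first.
  move=> j _; rewrite indicE mem_setE in_strip.
  have [/andP[h1 h2]|_] := boolP (_ <= _ < _); last by rewrite mulr0.
  exfalso; move/negP: out; apply.
  have j0 : (0 : R) <= j%:R by rewrite ler0n.
  have j1 : j%:R + 1 <= (m%:R : R) by rewrite natr1 ler_nat.
  by apply/andP; split; nra.
have Lt : L <= `|t - c|.
  rewrite leNgt; apply: contra out; rewrite ltr_norml => /andP[? ?].
  by apply/andP; split; lra.
have -> : (t - c) ^+ 2 = `|t - c| ^+ 2 by rewrite -normrX ger0_norm ?sqr_ge0.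
apply: ler_wpDl; first exact: ltW.
by rewrite ler_pdivlMr// expr2 ler_wpM2l.
Qed.

Lemma imbalance_step_bound (T : finType) (x : T -> R) (A : {set T}) (c L : R) (m : nat) :
  #|A| = #|~: A| -> 0 < L -> (0 < m)%N ->
  `|imbalance x A| <=
    `|\sum_i \sum_(k < m) ((-1) ^+ (i \notin A) * step_value L m k) *
        \1_([set` strip (c - L) (2 * L / m%:R) k]) (x i)|
    + (#|T|%:R * (2 * L / m%:R) + \sum_i (x i - c) ^+ 2 / L).
Proof.
move=> cA L0 m0.
(* The groups have equal size, so centring at [c] changes nothing. *)
have -> : imbalance x A = \sum_i (-1) ^+ (i \notin A) * (x i - c).
  rewrite [RHS](bigID (mem A))/= /imbalance.
  rewrite [X in _ = X + _](eq_bigr (fun i => x i - c)); last first.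
    by move=> i iA; rewrite iA expr0 mul1r.
  rewrite [X in _ = _ + X](eq_bigr (fun i => - (x i) + c)); last first.
    by move=> i iA; rewrite iA expr1 mulN1r opprB addrC.
  rewrite sumrB big_split/= sumrN !sumr_const.
  rewrite [X in _ - X = _](eq_bigl (fun i => i \notin A)); last by move=> i; rewrite inE.
  rewrite (_ : #|[pred i | i \notin A]| = #|~: A|); last first.
    by apply: eq_card => i; rewrite !inE.
  by rewrite -cA; lra.
set S := \sum_i \sum_(k < m) _.
rewrite -lerBlDl; apply: le_trans (lerB_dist _ _) _.
rewrite /S -sumrB; apply: le_trans (ler_norm_sum _ _ _) _.
rewrite -sum1_card natr_sum mulr_suml -big_split/=; apply: ler_sum => i _.
under eq_bigr do rewrite -mulrA.
rewrite -mulr_sumr -mulrBr normrM normrX normrN1 expr1n !mul1r.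
exact: step_approx.
Qed.

End StepApproximation.

Section ImbalanceLLN.
Context {d : measure_display} {Omega : measurableType d} {R : realType}.
Variable P : probability Omega R.
Context {T : finType}.
Variable X : T -> {RV P >-> R}.
Hypothesis indep : mutually_independent P X.

Lemma measurable_statistic_imbalance (A : {set T}) :
  measurable_statistic (fun x : T -> R => imbalance x A).
Proof.
move=> d' Omega' Y mY; rewrite /imbalance.
apply: measurable_funB.
  under eq_fun do rewrite big_mkcond.
  by apply: measurable_sum => i; case: (i \in A).
under eq_fun do rewrite big_mkcond.
by apply: measurable_sum => i; case: (i \in ~: A)%SET.
Qed.

(** kappa n is split into thirds: the step sum, of mean 0 because the laws agree and the signs
    cancel (Chebyshev); the rounding error, small by [12 * L <= kappa * m%:R]; the quadratic error
    (Markov). The last bound does not vanish with n and is made small through L. *)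
Lemma prob_large_imbalance (A : {set T}) (n m : nat) (c L M kappa : R) :
  #|T| = (2 * n)%N -> #|A| = n -> (0 < n)%N -> (0 < m)%N -> 0 < L -> 0 < kappa ->
  (forall i, (\int[P]_w ((X i w - c) ^+ 2)%:E <= M%:E)%E) ->
  (forall i j (b : interval R), P (X i @^-1` [set` b]) = P (X j @^-1` [set` b])) ->
  12 * L <= kappa * m%:R ->
  (P [set w | ~ (`|imbalance (fun i => X i w) A| <= kappa * n%:R)%R] <=
   (18 * m%:R ^+ 2 * L ^+ 2 / (kappa ^+ 2 * n%:R) + 6 * M / (kappa * L))%:E)%E.
Proof.
move=> cT cA n0 m0 L0 k0 EM iid mL.
have n0R : (0 : R) < n%:R by rewrite ltr0n.
have m0R : (0 : R) < m%:R by rewrite ltr0n.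
have cA' : #|A| = #|~: A|.
  by have := cardsC A; rewrite cT cA; lia.
pose t : R := kappa * n%:R / 3.
have t0 : 0 < t by rewrite divr_gt0// mulr_gt0.
pose B (k : 'I_m) := [set` strip (c - L) (2 * L / m%:R) k].
have mB k : measurable (B k) by exact: measurable_itv.
pose v i (k : 'I_m) : R := (-1) ^+ (i \notin A) * step_value L m k.
have vL i k : `|v i k| <= L.
  rewrite /v normrM normrX normrN1 expr1n mul1r /step_value.
  have k1 : k%:R <= (m%:R : R) by rewrite ler_nat ltnW.
  have k2 : (0 : R) <= k%:R by rewrite ler0n.
  have : 0 <= k%:R * (2 * L / m%:R) by rewrite mulr_ge0// divr_ge0 ?ler0n// mulr_ge0// ltW.
  have : k%:R * (2 * L / m%:R) <= 2 * L.
    by rewrite mulrA ler_pdivrMr// mulrC ler_wpM2l// mulr_ge0// ltW.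
  by move=> h1 h2; rewrite ler_norml; apply/andP; split; lra.
pose F1 := [set w | t <= `|\sum_i \sum_k v i k * \1_(B k) (X i w)|].
pose g (x : T -> R) := \sum_i (x i - c) ^+ 2 / L.
pose F2 := [set w | t <= g (X ^~ w)].
have mX i : measurable_fun setT (X i) by exact: measurable_funP.
have mF1 : measurable F1.
  have := measurable_condition_ge_dist 0 t (measurable_statistic_step v mB) mX.
  by congr measurable; apply/seteqP; split => w /=; rewrite subr0.
have mg : measurable_statistic g.
  move=> d' Omega' Y mY; apply: measurable_sum => i.
  apply: measurable_funM => //; apply: measurable_funX.
  exact: measurable_funB.
have mF2 : measurable F2.
  have := measurable_condition_stat mg (measurable_itv `[t, +oo[) mX.
  by congr measurable; apply/seteqP; split => w /=; rewrite in_itv/= andbT.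
have PF1 : (P F1 <= (18 * m%:R ^+ 2 * L ^+ 2 / (kappa ^+ 2 * n%:R))%:E)%E.
  have := step_sum_deviation indep mB vL t0.
  have -> : \sum_i \sum_k v i k * pr P (X i @^-1` B k) = 0.
    have [i0 _|noT] := pickP (fun _ : T => true); last first.
      by rewrite big1// => i; have := noT i.
    transitivity (\sum_i (-1) ^+ (i \notin A) * \sum_(k < m) step_value L m k *
      pr P (X i0 @^-1` B k)).
      apply: eq_bigr => i _; rewrite mulr_sumr; apply: eq_bigr => k _.
      by rewrite /v mulrA /pr (iid i i0).
    rewrite -mulr_suml (_ : \sum_i _ = 0) ?mul0r//.
    rewrite (bigID (mem A))/= (eq_bigr (fun=> 1)); last by move=> i ->; rewrite expr0.
    rewrite [X in _ + X](eq_bigr (fun=> -1)); last by move=> i ->; rewrite expr1.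
    rewrite !sumr_const (_ : #|[pred i | i \notin A]| = #|~: A|); last first.
      by apply: eq_card => i; rewrite !inE.
    by rewrite -cA' mulNrn subrr.
  under eq_set do rewrite subr0.
  move=> /le_trans; apply; rewrite lee_fin cT natrM le_eqVlt; apply/orP; left.
  by apply/eqP; rewrite /t; field; rewrite !gt_eqF.
have PF2 : (P F2 <= (6 * M / (kappa * L))%:E)%E.
  have mgX := mg _ _ _ mX.
  pose Y : {RV P >-> R} := HB.pack (fun w => g (X ^~ w))
    (isMeasurableFun.Build _ _ _ _ (fun w => g (X ^~ w)) mgX).
  have g0 x : 0 <= g x.
    by apply: sumr_ge0 => i _; rewrite divr_ge0 ?sqr_ge0// ltW.
  have := @markov _ _ _ P Y id t t0 (@measurable_id _ _ _) (fun r => id).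
  have -> : [set x | (t%:E <= `|(Y x)%:E|)%E] = F2.
    by apply/seteqP; split => w /=; rewrite lee_fin ger0_norm.
  move=> /(_ (fun x y _ _ => id)).
  rewrite unlock /=.
  have -> : (\int[P]_w (`|g (X ^~ w)|)%:E = \sum_i \int[P]_w (((X i w - c) ^+ 2 / L)%:E))%E.
    rewrite -ge0_integral_sum//.
    - apply: eq_integral => w _; rewrite sumEFin; congr EFin.
      by rewrite ger0_norm.
    - move=> i; apply/measurable_EFinP; apply: measurable_funM => //.
      by apply: measurable_funX; exact: measurable_funB.
    - by move=> i w _; rewrite lee_fin divr_ge0 ?sqr_ge0// ltW.
  have ile i : (\int[P]_w (((X i w - c) ^+ 2 / L)%:E) <= (M / L)%:E)%E.
    under eq_integral do rewrite EFinM.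
    rewrite ge0_integralZr//.
    - by rewrite [leRHS]EFinM lee_wpmul2r// lee_fin invr_ge0 ltW.
    - apply/measurable_EFinP; apply: measurable_funX; exact: measurable_funB.
    - by move=> w _; rewrite lee_fin sqr_ge0.
    - by rewrite lee_fin invr_ge0 ltW.
  move=> H; have {}H := le_trans H (lee_sum _ (fun i _ => ile i)).
  rewrite sumEFin sumr_const cT -[_ *+ (2 * n)]mulr_natr in H.
  rewrite -(prK P mF2) -EFinM lee_fin in H.
  rewrite -(prK P mF2) lee_fin.
  rewrite -(ler_pM2l t0); apply: (le_trans H).
  by rewrite natrM le_eqVlt /t; apply/orP; left; apply/eqP; field; rewrite !gt_eqF.
apply: (@le_trans _ _ (P (F1 `|` F2))); last first.
  apply: (le_trans (measureU2 _ mF1 mF2)).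
  by rewrite EFinD; exact: leeD.
apply: le_measure; rewrite ?inE.
- apply: (measurable_conditionN (Q := fun x :
  T -> R => `|imbalance x A| <= kappa * n%:R)) => //.
  have ms := measurable_statistic_imbalance A.
  move=> d' Omega' Y mY.
  have := measurable_condition_stat ms (measurable_itv `[- (kappa * n%:R), kappa * n%:R]) mY.
  by congr measurable; apply/seteqP; split => w /=; rewrite in_itv/= ler_norml.
- exact: measurableU.
- move=> w /= /negP; rewrite -ltNge => big.
  have := @imbalance_step_bound _ _ (X ^~ w) A c L m cA' L0 m0.
  have h : #|T|%:R * (2 * L / m%:R) <= t.
    by rewrite cT natrM /t mulrA ler_pdivrMr//; nra.
  move=> H; have [F1w|F1w] := boolP (t <= `|\sum_i \sum_k v i k * \1_(B k) (X i w)|);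
    first by left.
  right; rewrite /F2 /= leNgt; apply/negP => gt; move: F1w; rewrite -ltNge => F1w.
  move: H; rewrite leNgt => /negP; apply; rewrite /g in gt.
  apply: lt_trans big.
  have -> : kappa * n%:R = t + (t + t) by rewrite /t; lra.
  by apply: ltrD F1w _; apply: ler_ltD.
Qed.

End ImbalanceLLN.

(** * Union bounds *)

Section UnionBounds.
Context {d : measure_display} {Omega : measurableType d} {R : realType}.
Variable P : probability Omega R.
Context {T : Type}.
Variable X : T -> {RV P >-> R}.

Definition prob_at_most (Q : (T -> R) -> Prop) (b : R) :=
  measurable_condition Q /\ (P [set w | Q (fun i => X i w)] <= b%:E)%E.

Let mX i : measurable_fun setT (X i).
Proof. exact: measurable_funP. Qed.

Lemma prob_at_most_le Q b b' : b <= b' -> prob_at_most Q b -> prob_at_most Q b'.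
Proof. by move=> bb [mQ Qb]; split => //; apply: le_trans Qb _; rewrite lee_fin. Qed.

Lemma prob_at_most_or Q1 Q2 b1 b2 : prob_at_most Q1 b1 -> prob_at_most Q2 b2 ->
  prob_at_most (fun x => Q1 x \/ Q2 x) (b1 + b2).
Proof.
move=> [m1 l1] [m2 l2]; split; first exact: measurable_condition_or.
rewrite EFinD; apply: le_trans (leeD l1 l2).
exact: (measureU2 _ (m1 _ _ _ mX) (m2 _ _ _ mX)).
Qed.

Lemma prob_at_most_ex (N : nat) (Q : nat -> (T -> R) -> Prop) (b : nat -> R) :
  (forall k, (k < N)%N -> prob_at_most (Q k) (b k)) ->
  prob_at_most (fun x => exists k, (k < N)%N /\ Q k x) (\sum_(k < N) b k).
Proof.
elim: N => [|N IH] H.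
  split; last first.
    rewrite big_ord0 (_ : [set w | _] = set0) ?measure0//.
    by apply/seteqP; split => w //= [k []].
  move=> d' O' Y mY; rewrite (_ : [set w | _] = set0)//.
  by apply/seteqP; split => w //= [k []].
have H1 := IH (fun k kN => H k (ltnW kN)).
have := prob_at_most_or H1 (H N (ltnSn N)).
rewrite big_ord_recr/=; congr prob_at_most; apply/funext => x; apply/propext; split.
  by move=> [[k [kN Qk]]|QN]; [exists k; split => //; exact: ltnW|exists N].
move=> [k [kN Qk]]; have [kN'|] := ltnP k N; first by left; exists k.
move=> Nk; right; suff -> : N = k by [].
by apply/eqP; rewrite eqn_leq Nk -ltnS.
Qed.

Lemma prob_at_most_ex_fin (I : finType) (Q : I -> (T -> R) -> Prop) (b : R) :
  (forall i, prob_at_most (Q i) b) ->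
  prob_at_most (fun x => exists i, Q i x) (#|I|%:R * b).
Proof.
move=> H; split; first by apply: measurable_condition_ex => i; case: (H i).
pose Qk k (x : T -> R) := exists i, enum_rank i = k :> nat /\ Q i x.
have HQ k : (k < #|I|)%N -> prob_at_most (Qk k) b.
  move=> kI.
  have -> : Qk k = Q (enum_val (Ordinal kI)).
    apply/funext => x; apply/propext; split.
      move=> [i [ik Qi]]; rewrite (_ : Ordinal kI = enum_rank i) ?enum_rankK//.
      exact/val_inj.
    by move=> Qi; exists (enum_val (Ordinal kI)); rewrite enum_valK.
  exact: H.
have [_] := prob_at_most_ex HQ.
rewrite sumr_const card_ord mulr_natl; apply: le_trans.
rewrite le_eqVlt; apply/orP; left; apply/eqP; congr (P _); apply/seteqP; split => w /=.
  by move=> [i Qi]; exists (enum_rank i); split => //; exists i.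
by move=> [k [_ [i [_ Qi]]]]; exists i.
Qed.

Lemma prob_at_most_sub Q Q' b : measurable_condition Q -> (forall x, Q x -> Q' x) ->
  prob_at_most Q' b -> prob_at_most Q b.
Proof.
move=> mQ QQ' [mQ' Qb]; split => //; apply: le_trans Qb.
apply: le_measure; rewrite ?inE; [exact: (mQ _ _ _ mX)|exact: (mQ' _ _ _ mX)|].
by move=> w; exact: QQ'.
Qed.

End UnionBounds.

(** * Failure probabilities under local bounds on the density *)

Section LocalDensity.
Context {d : measure_display} {Omega : measurableType d} {R : realType}.
Variable P : probability Omega R.
Context {n : nat}.
Variable X : 'I_(2 * n) -> {RV P >-> R}.
Hypothesis indep : mutually_independent P X.
Variables (o lam f0 F : R).
Hypotheses (lam_gt0 : 0 < lam) (f0_gt0 : 0 < f0).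
Hypothesis law : forall i a b, o <= a -> a <= b -> b <= o + 90 * lam ->
  f0 * (b - a) <= pr P (X i @^-1` [set` `[a, b[]) <= F * (b - a).

Lemma law_strip i a w k : 0 <= w -> o <= a + k%:R * w -> a + k.+1%:R * w <= o + 90 * lam ->
  f0 * w <= pr P (X i @^-1` [set` strip a w k]) <= F * w.
Proof.
move=> w0 h1 h2; have e : a + k.+1%:R * w - (a + k%:R * w) = w by rewrite -natr1; lra.
by have := @law i _ _ h1 _ h2; rewrite e; apply; rewrite -subr_ge0 e.
Qed.

Lemma measurable_condition_window (A : {set 'I_(2 * n)}) (m q r : nat) (s : bool) :
  measurable_condition (fun x : 'I_(2 * n) -> R => has_window x o lam A m q r s).
Proof.
do 3![apply: measurable_condition_ex => ?]; apply: measurable_condition_and5;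
  try exact: measurable_condition_cst.
  exact: (measurable_condition_coord _ (measurable_itv _)).
exact: (measurable_condition_coord _ (measurable_itv _)).
Qed.

Lemma strip_disjoint (a w : R) (c c' : nat) : 0 < w -> c != c' ->
  [set` strip a w c] `&` [set` strip a w c'] = set0.
Proof.
move=> w0 cc; apply/seteqP; split => t //= [].
wlog lt : c c' cc / (c < c')%N.
  move=> H; move: (cc); rewrite neq_ltn => /orP[lt|lt] h1 h2; first exact: (H _ _ cc lt).
  by apply: (H _ _ _ lt) => //; rewrite eq_sym.
rewrite !in_itv/= => /andP[_ h1] /andP[h2 _].
have : (c.+1%:R : R) <= c'%:R by rewrite ler_nat.
by move=> h3; have := ler_wpM2r (ltW w0) h3; lra.
Qed.

Lemma prob_no_window (A : {set 'I_(2 * n)}) (m q r : nat) (s : bool) :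
  #|A| = n -> (0 < n)%N -> (0 < m)%N -> (q <= m)%N -> (r < 11)%N ->
  prob_at_most X (fun x => ~ has_window x o lam A m q r s)
    (F ^+ 2 / (16 * lam ^+ 2 * f0 ^+ 4) * (m%:R / n%:R ^+ 2 + 8 * F * lam / n%:R)).
Proof.
move=> cA n0 m0 qm r11; split.
  exact/measurable_conditionN/measurable_condition_window.
have l0 := lam_gt0; have f00 := f0_gt0.
have n0R : (0 : R) < n%:R by rewrite ltr0n.
have m0R : (0 : R) < m%:R by rewrite ltr0n.
pose w : R := 4 * lam / m%:R.
have w0 : 0 < w by rewrite divr_gt0// mulr_gt0.
have mw : m%:R * w = 4 * lam by rewrite /w mulrC divfK// gt_eqF.
pose a := block_start o lam r.
have cA' : #|~: A| = n.
  by have := cardsC A; rewrite card_ord cA; lia.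
pose U c : set R := [set` strip a w (c + if s then 0 else q)%N].
pose V c : set R := [set` strip a w (c + if s then q else 0)%N].
have strip_in k : (k < 2 * m)%N -> o <= a + k%:R * w /\ a + k.+1%:R * w <= o + 90 * lam.
  move=> km; have k1 : (k.+1%:R : R) <= 2 * m%:R by rewrite -natrM ler_nat.
  have k0 : (0 : R) <= k%:R by rewrite ler0n.
  have r1 : (r%:R : R) <= 10 by rewrite ler_nat.
  have r0 : (0 : R) <= r%:R by rewrite ler0n.
  have := ler_wpM2r (ltW w0) k1; have := mulr_ge0 k0 (ltW w0).
  have := mulr_ge0 r0 (ltW l0); have := ler_wpM2r (ltW l0) r1.
  by rewrite /a /block_start; split; lra.
have prU i c : (c < m)%N -> f0 * w <= pr P (X i @^-1` U c) <= F * w.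
  move=> cm; have [off _] := window_offset s cm qm; have [h1 h2] := strip_in _ off.
  by apply: law_strip => //; exact: ltW.
have prV i c : (c < m)%N -> f0 * w <= pr P (X i @^-1` V c) <= F * w.
  move=> cm; have [_ off] := window_offset s cm qm; have [h1 h2] := strip_in _ off.
  by apply: law_strip => //; exact: ltW.
have dU c c' : c != c' -> U c `&` U c' = set0.
  by move=> cc; apply: strip_disjoint => //; rewrite eqn_add2r.
have dV c c' : c != c' -> V c `&` V c' = set0.
  by move=> cc; apply: strip_disjoint => //; rewrite eqn_add2r.
have := prob_no_pair_in_windows indep cA cA' (fun c => measurable_itv _) (fun c =>
  measurable_itv _)
  dU dV (mulr_gt0 f00 w0) prU prV n0 m0.
move=> /le_trans; apply; rewrite lee_fin le_eqVlt; apply/orP; left; apply/eqP.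
by rewrite /w; field; rewrite !gt_eqF.
Qed.

Definition close_triple (m : nat) (x : 'I_(2 * n) -> R) := exists i j l,
  [/\ uniq [:: i; j; l], o + lam <= x i, x i < o + 89 * lam,
      `|x i - x j| <= 16 * lam / m%:R & `|x i - x l| <= 16 * lam / m%:R].

Lemma measurable_condition_dist (i j : 'I_(2 * n)) (h : R) :
  measurable_condition (fun x : 'I_(2 * n) -> R => `|x i - x j| <= h).
Proof.
have ms : measurable_statistic (fun x : 'I_(2 * n) -> R => x i - x j).
  by move=> d' O' Y mY; exact: measurable_funB.
move=> d' O' Y mY.
have := measurable_condition_stat ms (measurable_itv `[- h, h]) mY.
by congr measurable; apply/seteqP; split => w /=; rewrite in_itv/= ler_norml.
Qed.

Lemma measurable_condition_close_triple (m : nat) :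
  measurable_condition (close_triple m).
Proof.
apply: measurable_condition_ex => i; apply: measurable_condition_ex => j;
  apply: measurable_condition_ex => l.
apply: measurable_condition_and5; try exact: measurable_condition_dist.
- exact: measurable_condition_cst.
- move=> d' O' Y mY.
  have := measurable_condition_coord i (measurable_itv `[o + lam, +oo[) mY.
  by congr measurable; apply/seteqP; split => w /=; rewrite in_itv/= andbT.
- move=> d' O' Y mY.
  have := measurable_condition_coord i (measurable_itv `]-oo, o + 89 * lam[) mY.
  by congr measurable; apply/seteqP; split => w /=; rewrite in_itv/=.
Qed.

(** With i in a given strip of width w = 4 lam / m, the two others are within 4 w of it, hence in a
    fixed interval of width 10 w. There are 22 m strips, and the margins of length lam at both ends
    absorb the excess, as 5 w <= lam. *)
Lemma prob_close_triple (m : nat) : (20 <= m)%N ->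
  prob_at_most X (close_triple m)
    ((2 * n)%:R ^+ 3 * (22 * m)%:R * (100 * F ^+ 3 * (4 * lam / m%:R) ^+ 3)).
Proof.
move=> m20; have l0 := lam_gt0; have f00 := f0_gt0.
have m0R : (0 : R) < m%:R by rewrite ltr0n; lia.
pose w : R := 4 * lam / m%:R; pose a := o + lam.
have w0 : 0 < w by rewrite divr_gt0// mulr_gt0.
have mw : m%:R * w = 4 * lam by rewrite /w mulrC divfK// gt_eqF.
have w5 : 5 * w <= lam.
  have : (20 : R) <= m%:R by rewrite ler_nat.
  by move=> /(ler_wpM2r (ltW w0)); lra.
pose U (c : nat) := strip a w c.
pose V (c : nat) : interval R := `[a + c%:R * w - 4 * w, a + c%:R * w + 6 * w[.
pose Q (p : 'I_(2 * n) * 'I_(2 * n) * 'I_(2 * n)) c (x : 'I_(2 * n) -> R) :=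
  [/\ uniq [:: p.1.1; p.1.2; p.2], x p.1.1 \in U c, x p.1.2 \in V c, x p.2 \in V c & True].
apply: (prob_at_most_sub (Q' := fun x => exists p, exists c, (c < 22 * m)%N /\ Q p c x)).
- exact: measurable_condition_close_triple.
- move=> x [i [j [l [u i1 i2 ij il]]]]; exists (i, j, l).
  have d0 : 0 <= (x i - a) / w by rewrite divr_ge0 ?subr_ge0// ltW.
  have /andP[k1 k2] := truncn_itv d0.
  set k := Num.truncn _ in k1 k2.
  rewrite ler_pdivlMr// in k1; rewrite ltr_pdivrMr// -natr1 in k2.
  have e16 : 16 * lam / m%:R = 4 * w by rewrite /w !mulrA -natrM.
  move: ij il; rewrite e16 !ler_norml => /andP[ij1 ij2] /andP[il1 il2].
  exists k; split.
    rewrite -(ltr_nat R) -(ltr_pM2r w0) natrM -mulrA mw; apply: le_lt_trans k1 _.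
    by rewrite /a; lra.
  by split; rewrite // /U /V ?in_strip ?in_itv/=; apply/andP; split; lra.
have -> : (2 * n)%:R ^+ 3 * (22 * m)%:R * (100 * F ^+ 3 * w ^+ 3) =
    #|{: 'I_(2 * n) * 'I_(2 * n) * 'I_(2 * n)}|%:R * (\sum_(c < 22 * m) 100 * F ^+ 3 * w ^+ 3).
  rewrite !card_prod !card_ord sumr_const card_ord.
  rewrite (natrM _ (2 * n * (2 * n)) (2 * n)) (natrM _ (2 * n) (2 * n)).
  by rewrite -[(_ * w ^+ 3) *+ _]mulr_natl; set M := (22 * m)%:R; set N := (2 * n)%:R; ring.
apply: prob_at_most_ex_fin => p.
apply: (@prob_at_most_ex _ _ _ P _ X (22 * m) (Q p) (fun=> 100 * F ^+ 3 * w ^+ 3)) =>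
  c cm; split.
  apply: measurable_condition_and5; try exact: measurable_condition_cst;
    exact: (measurable_condition_coord _ (measurable_itv _)).
case: p => [[i j] l].
have c0 : (0 : R) <= c%:R by rewrite ler0n.
have cR : c.+1%:R <= (22 * m)%:R :> R by rewrite ler_nat.
have cR' := ler_wpM2r (ltW w0) cR; rewrite natrM -[22 * _ * _]mulrA mw -natr1 in cR'.
have cw := mulr_ge0 c0 (ltW w0).
have pU : pr P (X i @^-1` [set` U c]) <= F * w.
  have h1 : o <= a + c%:R * w by rewrite /a; lra.
  have h2 : a + c.+1%:R * w <= o + 90 * lam by rewrite /a -natr1; lra.
  by have /andP[] := law_strip i (ltW w0) h1 h2.
have pV k : pr P (X k @^-1` [set` V c]) <= 10 * F * w.
  have -> : 10 * F * w = F * ((a + c%:R * w + 6 * w) - (a + c%:R * w - 4 * w)) by lra.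
  have h1 : o <= a + c%:R * w - 4 * w by rewrite /a; lra.
  have h2 : a + c%:R * w - 4 * w <= a + c%:R * w + 6 * w by lra.
  have h3 : a + c%:R * w + 6 * w <= o + 90 * lam by rewrite /a; lra.
  by have /andP[] := law k h1 h2 h3.
have Fw0 : 0 <= F * w by apply: le_trans pU; exact: pr_ge0.
have [u|Nu] := boolP (uniq [:: i; j; l]); last first.
  rewrite (_ : [set _ | _] = set0) ?measure0 ?lee_fin.
    have -> : 100 * F ^+ 3 * w ^+ 3 = 100 * (F * w) ^+ 3 by ring.
    by rewrite mulr_ge0// exprn_ge0.
  by apply/seteqP; split => // z [u' _ _ _ _]; exfalso; exact: (negP Nu u').
rewrite (_ : [set _ | _] = X i @^-1` [set` U c] `&` (X j @^-1` [set` V c] `&` X l @^-1`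
  [set` V c])); last first.
  by apply/seteqP; split => z; [move=> [_ h1 h2 h3 _] //|move=> [h1 [h2 h3]]; split].
rewrite -(prK P); last first.
  by apply: measurableI; [|apply: measurableI]; apply: measurable_ev; exact: measurable_itv.
rewrite (pr_ev3 indep u)//; try exact: measurable_itv.
have -> : 100 * F ^+ 3 * w ^+ 3 = (F * w) * ((10 * F * w) * (10 * F * w)) by ring.
by rewrite lee_fin ler_pM ?mulr_ge0 ?pr_ge0 ?ler_pM ?pr_ge0.
Qed.

End LocalDensity.

(** * The bad event *)

(** Cells 0 and 89 are so far apart that, wherever the mean falls, all points of one of them are at
    distance at least [lam] from it. *)
Lemma stdev_lower {R : realType} {n : nat} (x : 'I_(2 * n) -> R) (A : {set 'I_(2 * n)})
    (o lam K : R) : (0 < n)%N -> 0 < lam ->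
  K <= #|[set i in A | x i \in strip o lam 0]%SET|%:R ->
  K <= #|[set i in A | x i \in strip o lam 89]%SET|%:R ->
  Num.sqrt (K * lam ^+ 2 / (2 * n)%:R) <= stdev x.
Proof.
move=> n0 l0 K0 K1; rewrite /stdev ler_wsqrtr// ler_wpM2r ?invr_ge0//.
set mu := mean_all x.
have far c : (forall y, y \in strip o lam c -> lam ^+ 2 <= (y - mu) ^+ 2) ->
    K <= #|[set i in A | x i \in strip o lam c]%SET|%:R ->
    K * lam ^+ 2 <= \sum_i (x i - mu) ^+ 2.
  move=> fc Kc; set S := [set i in A | x i \in strip o lam c]%SET in Kc.
  apply: (le_trans (y := \sum_(i in S) lam ^+ 2)).
    by rewrite sumr_const -mulr_natl ler_wpM2r ?exprn_ge0// ltW.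
  rewrite [leRHS](bigID (mem S))/= -[leLHS]addr0; apply: lerD.
    by apply: ler_sum => i; rewrite inE => /andP[_ xi]; exact: fc.
  by apply: sumr_ge0 => i _; exact: sqr_ge0.
have [le|gt] := leP mu (o + 2 * lam).
  apply: (far 89%N) K1 => y; rewrite in_strip => /andP[h _].
  by rewrite ler_sqr ?nnegrE; lra.
apply: (far 0%N) K0 => y; rewrite in_strip => /andP[_ h].
by rewrite -[leRHS]sqrrN ler_sqr ?nnegrE; lra.
Qed.

Section BadEvent.
Context {R : realType} {n : nat}.
Variables (A : {set 'I_(2 * n)}) (o lam f0 : R) (m1 m2 m3 Q2 Q3 J : nat).

Definition missing_window (m q : nat) (x : 'I_(2 * n) -> R) :=
  exists r, (r < 11)%N /\ exists s : bool, ~ has_window x o lam A m q r s.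

Definition sparse_cell (D : {set 'I_(2 * n)}) (x : 'I_(2 * n) -> R) :=
  exists c, (c < 90)%N /\
    ~ n%:R * (f0 * lam) / 2 < #|[set i in D | x i \in strip o lam c]%SET|%:R.

(** The threshold for cells is half the lower bound n f0 lam on the expected count, and the
    threshold for the imbalance is [lam] times it, as the coarse phase requires. *)
Definition bad_event (x : 'I_(2 * n) -> R) :=
  sparse_cell A x \/ sparse_cell (~: A)%SET x \/
  ~ `|imbalance x A| <= f0 * lam ^+ 2 / 2 * n%:R \/
  (exists q, (q < m1.+1)%N /\ missing_window m1 q x) \/
  (exists q, (q < Q2.+1)%N /\ missing_window m2 q x) \/
  (exists q, (q < Q3.+1)%N /\ missing_window m3 q x) \/
  (exists k, (k < J.+1)%N /\ missing_window (m3 * 2 ^ k) 3 x) \/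
  close_triple o lam m3 x.

End BadEvent.

Lemma greedy_balance_bound {R : realType} {n : nat} (x : 'I_(2 * n) -> R)
    (A0 B : allocation n) (o lam f0 : R) (m1 m2 m3 Q2 Q3 J : nat) :
  (0 < n)%N -> 0 < lam -> 0 < f0 -> greedy_run x A0 B ->
  (16 <= m1)%N -> (0 < m2)%N -> (3 <= m3)%N ->
  (2 * m2 <= Q2 * m1)%N -> (2 * m3 <= Q3 * m2)%N -> (Q2 <= m2)%N -> (Q3 <= m3)%N ->
  ~ bad_event (val A0) o lam f0 m1 m2 m3 Q2 Q3 J x ->
  balance x B <= 16 * lam / (m3 * 2 ^ J)%:R / (n%:R * Num.sqrt (f0 * lam ^+ 3 / 4)).
Proof.
move=> n0 l0 f00 run m1_16 m2_0 m3_3 mQ2 mQ3 Qm2 Qm3 good.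
have n0R : (0 : R) < n%:R by rewrite ltr0n.
have [cT good1] : ~ sparse_cell o lam f0 (val A0) x /\ ~ (sparse_cell o lam f0 (~: val A0) x \/
  ~ `|imbalance x (val A0)| <= f0 * lam ^+ 2 / 2 * n%:R \/
  (exists q, (q < m1.+1)%N /\ missing_window (val A0) o lam m1 q x) \/
  (exists q, (q < Q2.+1)%N /\ missing_window (val A0) o lam m2 q x) \/
  (exists q, (q < Q3.+1)%N /\ missing_window (val A0) o lam m3 q x) \/
  (exists k, (k < J.+1)%N /\ missing_window (val A0) o lam (m3 * 2 ^ k) 3 x) \/
  close_triple o lam m3 x).
  by apply/not_orP.
move: good1 => /not_orP[cC /not_orP[/contrapT small /not_orP[w1 /not_orP[w2 /not_orP[w3
  /not_orP[wJ tri]]]]]].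
set K := n%:R * (f0 * lam) / 2.
have many D : ~ sparse_cell o lam f0 D x -> forall c, (c < 90)%N ->
    K < #|[set i in D | x i \in strip o lam c]%SET|%:R.
  by move=> nD c c90; apply: contrapT => h; apply: nD; exists c.
have {}cT := many _ cT; have {}cC := many _ cC.
have s0 : 0 < f0 * lam ^+ 3 / 4 by rewrite divr_gt0// mulr_gt0// exprn_gt0.
have sd : Num.sqrt (f0 * lam ^+ 3 / 4) <= stdev x.
  have -> : f0 * lam ^+ 3 / 4 = K * lam ^+ 2 / (2 * n)%:R.
    by rewrite natrM /K; field; rewrite gt_eqF.
  by apply: stdev_lower n0 l0 _ _; exact/ltW/cT.
have q0 : 0 < Num.sqrt (f0 * lam ^+ 3 / 4) by rewrite sqrtr_gt0.
have sd0 : 0 < stdev x by apply: lt_le_trans sd.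
have win m N : ~ (exists q, (q < N.+1)%N /\ missing_window (val A0) o lam m q x) ->
    forall q r s, (q <= N)%N -> (r < 11)%N -> has_window x o lam (val A0) m q r s.
  move=> nw q r s qN r11; apply: contrapT => h; apply: nw.
  by exists q; split => //; exists r; split => //; exists s.
have winJ k r s : (k <= J)%N -> (r < 11)%N -> has_window x o lam (val A0) (m3 * 2 ^ k) 3 r s.
  move=> kJ r11; apply: contrapT => h; apply: wJ.
  by exists k; split => //; exists r; split => //; exists s.
have trip i j l : o + lam <= x i < o + 89 * lam -> i != j -> i != l -> j != l ->
   `|x i - x j| <= 16 * lam / m3%:R -> `|x i - x l| <= 16 * lam / m3%:R -> False.
  move=> /andP[i1 i2] ij il jl d1 d2; apply: tri; exists i, j, l; split => //.
  by rewrite /= !inE negb_or ij il jl.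
have smallK : `|imbalance x (val A0)| <= lam * K.
  by rewrite (_ : lam * K = f0 * lam ^+ 2 / 2 * n%:R)// /K; lra.
have S := greedy_imbalance_bound l0 n0 sd0 run cT cC smallK m1_16 m2_0 m3_3 mQ2 mQ3 Qm2 Qm3
  (win _ _ w1) (win _ _ w2) (win _ _ w3) winJ trip.
rewrite balanceE//; apply: ler_pM => //.
  by rewrite invr_ge0 mulr_ge0 ?ler0n ?sqrtr_ge0.
by rewrite lef_pV2 ?posrE ?mulr_gt0// ler_pM2l.
Qed.

Section BadEventProbability.
Context {d : measure_display} {Omega : measurableType d} {R : realType}.
Variable P : probability Omega R.
Context {n : nat}.
Variable X : 'I_(2 * n) -> {RV P >-> R}.
Hypothesis indep : mutually_independent P X.
Variables (o lam f0 F c M L : R) (mm : nat).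
Hypotheses (lam_gt0 : 0 < lam) (f0_gt0 : 0 < f0) (n_gt0 : (0 < n)%N).
Hypothesis law : forall i a b, o <= a -> a <= b -> b <= o + 90 * lam ->
  f0 * (b - a) <= pr P (X i @^-1` [set` `[a, b[]) <= F * (b - a).
Hypothesis iid : forall i j (b : interval R), P (X i @^-1` [set` b]) = P (X j @^-1` [set` b]).
Hypothesis second_moment : forall i, (\int[P]_w ((X i w - c) ^+ 2)%:E <= M%:E)%E.
Hypotheses (L_gt0 : 0 < L) (mm_gt0 : (0 < mm)%N)
  (mmL : 12 * L <= f0 * lam ^+ 2 / 2 * mm%:R).

Definition window_bound (m : nat) : R :=
  F ^+ 2 / (16 * lam ^+ 2 * f0 ^+ 4) * (m%:R / n%:R ^+ 2 + 8 * F * lam / n%:R).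

Lemma prob_missing_window (A : {set 'I_(2 * n)}) (m q : nat) :
  #|A| = n -> (0 < m)%N -> (q <= m)%N ->
  prob_at_most X (missing_window A o lam m q) (22 * window_bound m).
Proof.
move=> cA m0 qm.
have -> : 22 * window_bound m = \sum_(r < 11) (#|{: bool}|%:R * window_bound m).
  by rewrite sumr_const card_ord card_bool -[_ *+ 11]mulr_natl mulrA -natrM.
apply: (@prob_at_most_ex _ _ _ P _ X 11
  (fun r x => exists s : bool, ~ has_window x o lam A m q r s)
  (fun=> #|{: bool}|%:R * window_bound m)) => r r11.
by apply: prob_at_most_ex_fin => s; exact: prob_no_window.
Qed.

Lemma prob_sparse_cell (A : {set 'I_(2 * n)}) : #|A| = n ->
  prob_at_most X (sparse_cell o lam f0 A) (90 * (8 / (n%:R * (f0 * lam) ^+ 2))).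
Proof.
move=> cA; have l0 := lam_gt0.
have -> : 90 * (8 / (n%:R * (f0 * lam) ^+ 2)) =
  \sum_(r < 90) (8 / (n%:R * (f0 * lam) ^+ 2)) :> R.
  by rewrite sumr_const card_ord mulr_natl.
apply: (@prob_at_most_ex _ _ _ P _ X 90
  (fun c x => ~ n%:R * (f0 * lam) / 2 < #|[set i in A | x i \in strip o lam c]%SET|%:R)
  (fun=> 8 / (n%:R * (f0 * lam) ^+ 2))) => k k90; split.
  exact/measurable_conditionN/measurable_condition_count.
apply: prob_few_in_interval => //; first by rewrite card_ord.
  exact: mulr_gt0.
move=> i; have k1 : (k.+1%:R : R) <= 90 by rewrite ler_nat.
have k0 : (0 : R) <= k%:R by rewrite ler0n.
have h1 : o <= o + k%:R * lam by rewrite lerDl mulr_ge0// ltW.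
have h2 : o + k.+1%:R * lam <= o + 90 * lam by rewrite lerD2l ler_wpM2r// ltW.
by have /andP[] := law_strip law i (ltW l0) h1 h2.
Qed.

Lemma prob_bad_event (A : {set 'I_(2 * n)}) (m1 m2 m3 Q2 Q3 J : nat) : #|A| = n ->
  (0 < m1)%N -> (0 < m2)%N -> (20 <= m3)%N -> (Q2 <= m2)%N -> (Q3 <= m3)%N ->
  prob_at_most X (bad_event A o lam f0 m1 m2 m3 Q2 Q3 J)
   (90 * (8 / (n%:R * (f0 * lam) ^+ 2)) + (90 * (8 / (n%:R * (f0 * lam) ^+ 2)) +
    (18 * mm%:R ^+ 2 * L ^+ 2 / ((f0 * lam ^+ 2 / 2) ^+ 2 * n%:R) +
      6 * M / (f0 * lam ^+ 2 / 2 * L) +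
    (\sum_(q < m1.+1) (22 * window_bound m1) + (\sum_(q < Q2.+1) (22 * window_bound m2) +
    (\sum_(q < Q3.+1) (22 * window_bound m3) +
      (\sum_(k < J.+1) (22 * window_bound (m3 * 2 ^ k)) +
    ((2 * n)%:R ^+ 3 * (22 * m3)%:R * (100 * F ^+ 3 * (4 * lam / m3%:R) ^+ 3))))))))).
Proof.
move=> cA m1_0 m2_0 m3_20 Qm2 Qm3; have m3_0 : (0 < m3)%N by apply: leq_trans m3_20.
have cA' : #|~: A| = n by have := cardsC A; rewrite card_ord cA; lia.
have k0 : 0 < f0 * lam ^+ 2 / 2 by rewrite divr_gt0// mulr_gt0// exprn_gt0.
do 2![apply: prob_at_most_or; first exact: prob_sparse_cell].
apply: prob_at_most_or.
  split; last by apply: prob_large_imbalance => //; rewrite card_ord.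
  apply: measurable_conditionN => d' O' Y mY.
  have := measurable_condition_stat (measurable_statistic_imbalance A)
    (measurable_itv `[- (f0 * lam ^+ 2 / 2 * n%:R), f0 * lam ^+ 2 / 2 * n%:R]) mY.
  by congr measurable; apply/seteqP; split => w /=; rewrite in_itv/= ler_norml.
apply: prob_at_most_or.
  by apply: (@prob_at_most_ex _ _ _ P _ X _ (missing_window A o lam m1) (fun=> 22 *
    window_bound m1)) => q qm;
    exact: prob_missing_window.
apply: prob_at_most_or.
  by apply: (@prob_at_most_ex _ _ _ P _ X _ (missing_window A o lam m2) (fun=> 22 *
    window_bound m2)) => q qm;
    apply: prob_missing_window => //; exact: leq_trans Qm2.
apply: prob_at_most_or.
  by apply: (@prob_at_most_ex _ _ _ P _ X _ (missing_window A o lam m3) (fun=> 22 *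
    window_bound m3)) => q qm;
    apply: prob_missing_window => //; exact: leq_trans Qm3.
apply: prob_at_most_or; last exact: (prob_close_triple indep lam_gt0 f0_gt0 law).
apply: (@prob_at_most_ex _ _ _ P _ X _ (fun k => missing_window A o lam (m3 * 2 ^ k) 3)
  (fun k => 22 * window_bound (m3 * 2 ^ k))) => k kJ.
apply: prob_missing_window => //; first by rewrite muln_gt0 m3_0 expn_gt0.
by rewrite (leq_trans _ (leq_pmulr _ _)) ?expn_gt0// (leq_trans _ m3_20).
Qed.

End BadEventProbability.

(** * Rates *)

Section Rates.
Context {R : realType}.

Lemma expr_ratio_le (Z : R) (a b : nat) : 1 <= Z -> (a < b)%N -> Z ^+ a / Z ^+ b <= Z^-1.
Proof.
move=> Z1 ab; have Z0 : 0 < Z by apply: lt_le_trans Z1.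
by rewrite ler_pdivrMr ?exprn_gt0// ler_pdivlMl// -exprS ler_weXn2l.
Qed.

Definition window_const (lam f0 F : R) : R :=
  F ^+ 2 / (16 * lam ^+ 2 * f0 ^+ 4) * (1 + 8 * F * lam).

Section Fixed.
Variables (lam f0 F : R) (n z : nat).
Hypotheses (lam_gt0 : 0 < lam) (f0_gt0 : 0 < f0) (F_ge0 : 0 <= F).
Hypotheses (z_ge4 : (4 <= z)%N) (zn : (z ^ 20 <= n)%N) (nz : (n <= (2 * z) ^ 20)%N).

Local Notation C1 := (window_const lam f0 F).
Local Notation Z := (z%:R : R).
Local Notation N := (n%:R : R).

Let Z1 : 1 <= Z. Proof. by rewrite ler1n; apply: leq_trans z_ge4. Qed.
Let Z0 : 0 < Z. Proof. exact: lt_le_trans Z1. Qed.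
Let N0 : 0 < N.
Proof. by rewrite ltr0n; apply: leq_trans zn; rewrite expn_gt0; move: z_ge4; case: (z). Qed.
Let ZN : Z ^+ 20 <= N. Proof. by rewrite -natrX ler_nat. Qed.
Let C1_ge0 : 0 <= C1.
Proof.
by rewrite mulr_ge0 ?divr_ge0 ?mulr_ge0 ?exprn_ge0 ?addr_ge0 ?mulr_ge0 ?(ltW lam_gt0)
  ?(ltW f0_gt0).
Qed.

Lemma inv_n_le : N^-1 <= Z^-1.
Proof.
rewrite lef_pV2 ?posrE//; apply: le_trans ZN.
by rewrite -[leLHS]expr1 ler_weXn2l.
Qed.

Lemma window_bound_le (m : nat) :
  window_bound (n := n) lam f0 F m <= C1 * (m%:R / N ^+ 2 + N^-1).
Proof.
rewrite /window_bound /window_const -[leRHS]mulrA; apply: ler_wpM2l.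
  by rewrite divr_ge0 ?mulr_ge0 ?exprn_ge0 ?(ltW lam_gt0) ?(ltW f0_gt0).
have : 0 <= 8 * F * lam by rewrite !mulr_ge0// ltW.
have : 0 <= m%:R / N ^+ 2 by rewrite divr_ge0// exprn_ge0// ltW.
have : 0 <= N^-1 by rewrite invr_ge0 ltW.
set u := 8 * F * lam; set s := _ / _; set t := N^-1 => t0 s0 u0.
by have := mulr_ge0 u0 s0; lra.
Qed.

(** There are of order Z^a targets, each missed with probability of order Z^b / Z^40: [20 <= b]
    makes this dominate 1 / n as well, and [a + b < 40] leaves a factor 1 / Z. *)
Lemma jump_bound_le (Q m q a b : nat) : (Q.+1)%:R <= 3 * Z ^+ a -> m%:R <= Z ^+ b ->
  (20 <= b)%N -> (a + b < 40)%N ->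
  \sum_(q < Q.+1) (22 * window_bound (n := n) lam f0 F m) <= 132 * C1 / Z.
Proof.
move=> Qa mb b20 ab.
have w0 : 0 <= C1 * (Z ^+ b / Z ^+ 40).
  by rewrite mulr_ge0// divr_ge0 ?exprn_ge0 ?(ltW Z0).
have w : window_bound (n := n) lam f0 F m <= 2 * (C1 * (Z ^+ b / Z ^+ 40)).
  apply: (le_trans (window_bound_le m)); rewrite [leRHS]mulrCA; apply: ler_wpM2l => //.
  rewrite [leRHS]mulr_natl mulr2n; apply: lerD.
    apply: ler_pM => //.
    rewrite lef_pV2 ?posrE ?exprn_gt0//.
    by rewrite (_ : 40 = 20 * 2)%N// exprM lerXn2r ?nnegrE ?exprn_ge0 ?(ltW Z0) ?(ltW N0).
  apply: (le_trans (y := (Z ^+ 20)^-1)); first by rewrite lef_pV2 ?posrE ?exprn_gt0.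
  rewrite ler_pdivlMr ?exprn_gt0// mulrC ler_pdivrMr ?exprn_gt0//.
  by rewrite -exprD ler_weXn2l// -[40%N]/(20 + 20)%N leq_add2r.
rewrite sumr_const card_ord -[_ *+ Q.+1]mulr_natl.
apply: (le_trans (y := (3 * Z ^+ a) * (22 * (2 * (C1 * (Z ^+ b / Z ^+ 40)))))).
  apply: (le_trans (y := Q.+1%:R * (22 * (2 * (C1 * (Z ^+ b / Z ^+ 40)))))).
    by apply: ler_wpM2l => //; apply: ler_wpM2l.
  by apply: ler_wpM2r => //; rewrite mulr_ge0// mulr_ge0.
have -> : (3 * Z ^+ a) * (22 * (2 * (C1 * (Z ^+ b / Z ^+ 40)))) =
  132 * C1 * (Z ^+ (a + b) / Z ^+ 40).
  by rewrite exprD; set p := Z ^+ a; set q' := Z ^+ b; set u := _^-1; ring.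
by apply: ler_wpM2l; [rewrite mulr_ge0|exact: expr_ratio_le].
Qed.

(** Since z^33 >= n, the term m / n^2 dominates 1 / n at every level. It doubles from level to
    level, so the sum is at most twice the last term, which is of order 1 / M0. *)
Lemma level_bound_le (M0 J : nat) : (0 < M0)%N -> (z ^ 33 * 2 ^ J * M0 <= n ^ 2)%N ->
  \sum_(k < J.+1) (22 * window_bound (n := n) lam f0 F (z ^ 33 * 2 ^ k)) <= 88 * C1 / M0%:R.
Proof.
move=> M00 small; have M0R : (0 : R) < M0%:R by rewrite ltr0n.
have nz33 : (n <= z ^ 33)%N.
  apply: (leq_trans nz); rewrite expnMn (_ : 33 = 13 + 20)%N// expnD leq_mul2r;
    apply/orP; right.
  (* 2^20 <= 2^26 = 4^13 <= z^13 uses z >= 4. *)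
  apply: (@leq_trans (4 ^ 13)); last by rewrite leq_exp2r.
  by rewrite -[4%N]/(2 ^ 2)%N -expnM leq_exp2l.
apply: (le_trans (y := \sum_(k < J.+1) (44 * C1 * (Z ^+ 33 / N ^+ 2)) * 2 ^+ k)).
  apply: ler_sum => k _.
  have w : window_bound (n := n) lam f0 F (z ^ 33 * 2 ^ k) <=
    C1 * (2 * (Z ^+ 33 * 2 ^+ k / N ^+ 2)).
    apply: (le_trans (window_bound_le _)); apply: ler_wpM2l => //.
    rewrite natrM !natrX; set u := _ / N ^+ 2.
    rewrite (_ : 2 * u = u + u); last by lra.
    rewrite lerD2l /u ler_pdivlMr ?exprn_gt0//.
    rewrite expr2 mulrA mulVf ?gt_eqF// mul1r -!natrX -natrM ler_nat.
    by apply: (leq_trans nz33); rewrite leq_pmulr// expn_gt0.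
  have : 22 * (C1 * (2 * (Z ^+ 33 * 2 ^+ k / N ^+ 2))) = 44 * C1 * (Z ^+ 33 / N ^+ 2) * 2 ^+ k.
    by rewrite -[_ * _ / _]mulrAC; set u := Z ^+ 33 / _; ring.
  by move=> <-; apply: ler_wpM2l.
rewrite -mulr_sumr.
have geo : \sum_(k < J.+1) (2 : R) ^+ k <= 2 * 2 ^+ J.
  elim: J {small} => [|j IH]; first by rewrite big_ord1 expr0; lra.
  by rewrite big_ord_recr/= exprS; lra.
have p0 : 0 <= 44 * C1 * (Z ^+ 33 / N ^+ 2).
  apply: mulr_ge0; first exact: mulr_ge0.
  by rewrite divr_ge0 ?exprn_ge0 ?(ltW Z0) ?(ltW N0).
apply: (le_trans (ler_wpM2l p0 geo)).
have smallR : Z ^+ 33 * 2 ^+ J * M0%:R <= N ^+ 2.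
  by rewrite -!natrX -!natrM ler_nat.
have -> : 44 * C1 * (Z ^+ 33 / N ^+ 2) * (2 * 2 ^+ J) = 88 * C1 * (Z ^+ 33 * 2 ^+ J / N ^+ 2).
  by rewrite -[Z ^+ 33 * _ / _]mulrAC; set u := Z ^+ 33 / _; ring.
apply: ler_wpM2l; first by rewrite mulr_ge0.
by rewrite ler_pdivrMr ?exprn_gt0// ler_pdivlMl// mulrC.
Qed.

(** n^3 is of order z^60, against z^(-66) for the squared scale. *)
Lemma triple_bound_le :
  (2 * n)%:R ^+ 3 * (22 * z ^ 33)%:R * (100 * F ^+ 3 * (4 * lam / (z ^ 33)%:R) ^+ 3) <=
  2 ^+ 60 * (8 * 22 * 100 * 64) * (F * lam) ^+ 3 / Z.
Proof.
have nzR : N <= 2 ^+ 20 * Z ^+ 20 by rewrite -exprMn -natrM -natrX ler_nat.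
have n3 : N ^+ 3 <= 2 ^+ 60 * Z ^+ 60.
  rewrite -[60%N]/(20 * 3)%N !exprM -exprMn lerXn2r// nnegrE; first exact: ltW.
  by rewrite mulr_ge0 ?exprn_ge0// ltW.
have zu : Z ^+ 33 != 0 by rewrite expf_neq0 ?gt_eqF.
have -> : (2 * n)%:R ^+ 3 * (22 * z ^ 33)%:R * (100 * F ^+ 3 * (4 * lam / (z ^ 33)%:R) ^+ 3) =
    (8 * 22 * 100 * 64) * (F * lam) ^+ 3 * (N ^+ 3 / Z ^+ 66).
  rewrite (natrM _ 2 n) (natrM _ 22) natrX -[66%N]/(33 + 33)%N exprD; set u := Z ^+ 33 in zu *.
  by field.
have -> : 2 ^+ 60 * (8 * 22 * 100 * 64) * (F * lam) ^+ 3 / Z =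
    8 * 22 * 100 * 64 * (F * lam) ^+ 3 * (2 ^+ 60 / Z).
  by set K : R := 2 ^+ 60; set u := _^-1; ring.
apply: ler_wpM2l.
  by rewrite mulr_ge0// exprn_ge0// mulr_ge0// ltW.
apply: (le_trans (y := 2 ^+ 60 * Z ^+ 60 / Z ^+ 66)).
  by rewrite ler_wpM2r// invr_ge0 exprn_ge0// ltW.
by rewrite -mulrA; apply: ler_wpM2l; [rewrite exprn_ge0|exact: expr_ratio_le].
Qed.

End Fixed.
End Rates.

(** * Densities and moments *)

Lemma unif_continuous_near {R : realType} (f : R -> R) (t e : R) :
  unif_continuous f -> 0 < e ->
  exists2 dl, 0 < dl & forall s, `|s - t| < dl -> `|f s - f t| < e.
Proof.
move=> /unif_continuousP uf e0; have [dl /= dl0 H] := uf e e0.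
exists dl => // s; exact: (H (s, t)).
Qed.

Section Density.
Context {d : measure_display} {Omega : measurableType d} {R : realType}.
Variable P : probability Omega R.

Lemma density_positive_somewhere (X : {RV P >-> R}) (f : R -> R) : has_density P X f ->
  exists t, 0 < f t.
Proof.
move=> [mf f0 fX]; apply: contrapT => /forallNP no.
have fE : f = cst 0.
  by apply/funext => t; apply/eqP; rewrite eq_le f0 andbT leNgt; apply/negP.
have := fX setT measurableT; rewrite probability_setT fE.
by rewrite integral0 => /eqP; rewrite onee_eq0.
Qed.

Lemma density_interval (X : {RV P >-> R}) (f : R -> R) (lo hi a b : R) :
  has_density P X f -> a <= b -> (forall t, a <= t -> t <= b -> lo <= f t <= hi) ->
  0 <= lo ->
  lo * (b - a) <= pr P (X @^-1` [set` `[a, b[]) <= hi * (b - a).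
Proof.
move=> [mf f0 fX] ab bd lo0.
have mI : measurable [set` `[a, b[ ] by exact: measurable_itv.
have PX : (pr P (X @^-1` [set` `[a, b[]))%:E = (\int[lebesgue_measure]_(t in [set` `[a,
  b[]) (f t)%:E)%E.
  rewrite prK; first exact: (fX _ mI).
  by rewrite -[X in measurable X]setTI; exact: measurable_funP.
have len : lebesgue_measure ([set` `[a, b[] : set R) = (b - a)%:E.
  rewrite lebesgue_measure_itv/= lte_fin; case: ltP => // ba.
  by rewrite (_ : b = a) ?subrr//; apply/le_anti; rewrite ab ba.
have mfI : measurable_fun [set` `[a, b[] (EFin \o f).
  by apply: measurable_funTS; exact/measurable_EFinP.
have hi0 : 0 <= hi by have := bd a (lexx _) ab; case/andP => /(le_trans lo0); exact: le_trans.
rewrite -!lee_fin PX !EFinM -!len -!integral_cst//; apply/andP; split.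
  apply: ge0_le_integral => // t /=; rewrite in_itv/= => /andP[t1 t2].
  by rewrite lee_fin; have /andP[] := bd t t1 (ltW t2).
apply: ge0_le_integral => //= t; first by rewrite lee_fin.
by rewrite in_itv/= lee_fin => /andP[t1 t2]; have /andP[] := bd t t1 (ltW t2).
Qed.

Lemma finite_variance_second_moment (X : {RV P >-> R}) : ('V_P[X] < +oo)%E ->
  (\int[P]_w ((X w - fine 'E_P[X]) ^+ 2)%:E <= (fine 'V_P[X])%:E)%E.
Proof.
move=> V; rewrite fineK; last by rewrite ge0_fin_numE// variance_ge0.
rewrite /variance covariance.unlock expectation.unlock.
by rewrite le_eqVlt; apply/orP; left; apply/eqP; apply: eq_integral => w _; rewrite expr2.
Qed.

(** Transfers the second moment from one reference covariate to all the others, so that the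
    constants depend neither on n nor on the individual. *)
Lemma same_density_integral (X Y : {RV P >-> R}) (f g : R -> R) :
  has_density P X f -> has_density P Y f -> measurable_fun setT g -> (forall t, 0 <= g t) ->
  (\int[P]_w (g (X w))%:E = \int[P]_w (g (Y w))%:E)%E.
Proof.
move=> [_ _ fX] [_ _ fY] mg g0.
have mG : measurable_fun setT (EFin \o g) by exact/measurable_EFinP.
have G0 y : (0 <= (EFin \o g) y)%E by rewrite lee_fin.
have <- := ge0_integral_distribution X mG G0.
have <- := ge0_integral_distribution Y mG G0.
by apply: eq_measure_integral => B mB _; exact: etrans (fX _ mB) (esym (fY _ mB)).
Qed.

End Density.

(** * Conditioning on the initial allocation *)

Section BalanceMeasurable.
Context {R : realType} {n : nat}.

Lemma measurable_statistic_stdev :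
  measurable_statistic (fun x : 'I_(2 * n) -> R => stdev x).
Proof.
move=> d Omega Y mY; rewrite /stdev.
have msqrt : measurable_fun setT (@Num.sqrt R).
  exact: continuous_measurable_fun (@sqrt_continuous R).
apply: (measurableT_comp msqrt); apply: measurable_funM => //.
apply: measurable_sum => i; apply: measurable_funX; apply: measurable_funB => //.
by apply: measurable_funM => //; exact: measurable_sum.
Qed.

(** If [stdev x] is 0, the quotient is 0 by the convention on division and the strict inequality
    fails. The right-hand side is free of division, so its measurability is direct. *)
Lemma lt_balance (t : R) (B : allocation n) (x : 'I_(2 * n) -> R) : (0 < n)%N -> 0 <= t ->
  (t < balance x B) =
  (0 < stdev x) && (0 < `|imbalance x (val B)| - t * (n%:R * stdev x)).
Proof.
move=> n0 t0; have [sd0|] := boolP (0 < stdev x).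
  rewrite balanceE// ltr_pdivlMr ?mulr_gt0 ?ltr0n//.
  by rewrite subr_gt0.
rewrite -leNgt => sd; rewrite /balance.
have -> : stdev x = 0 by apply/le_anti; rewrite sd sqrtr_ge0.
by rewrite invr0 mulr0 normr0; apply/negbTE; rewrite -leNgt.
Qed.

Lemma measurable_condition_balance (t : R) (B : allocation n) : (0 < n)%N -> 0 <= t ->
  measurable_condition (fun x : 'I_(2 * n) -> R => t < balance x B).
Proof.
move=> n0 t0 d Omega Y mY.
have m1 := measurable_condition_stat measurable_statistic_stdev (measurable_itv `]0, +oo[) mY.
have m2 : measurable_statistic (fun x :
  'I_(2 * n) -> R => `|imbalance x (val B)| - t * (n%:R * stdev x)).
  move=> d' O' Y' mY'; apply: measurable_funB.
    exact: measurableT_comp (@normr_measurable _ _) (measurable_statistic_imbalance (val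
      B) mY').
  apply: measurable_funM => //; apply: measurable_funM => //.
  exact: (measurable_statistic_stdev mY').
have := measurableI _ _ m1 (measurable_condition_stat m2 (measurable_itv `]0, +oo[) mY).
congr measurable; apply/seteqP; split => w; rewrite /= !in_itv/= !andbT lt_balance//.
  by move=> [-> ->].
by move=> /andP[].
Qed.

End BalanceMeasurable.

Section Conditioning.
Context {d : measure_display} {Omega : measurableType d} {R : realType}.
Variable P : probability Omega R.
Context {n : nat}.
Variables (X : 'I_(2 * n) -> {RV P >-> R}) (Y : Omega -> allocation n).

Lemma g_sigma_preimage_condition (Q : ('I_(2 * n) -> R) -> Prop) : measurable_condition Q ->
  g_sigma_preimage (fun i => X i : Omega -> R) [set w | Q (fun i => X i w)].
Proof.
move=> mQ.
(* The covariates are viewed on [Omega] with the sigma-algebra that they generate, where they are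
   measurable by construction. *)
pose G := \big[setU/set0]_(i < 2 * n)
  preimage_set_system setT (X i : Omega -> R) (@measurable _ (measurableTypeR R)).
pose Z (i : 'I_(2 * n)) : g_sigma_algebraType G -> R := X i.
apply: (mQ _ (g_sigma_algebraType G) Z) => i _ B mB; rewrite setTI.
apply: sub_sigma_algebra; rewrite /G (bigD1 i)//=; left.
by exists B => //; rewrite setTI.
Qed.

Lemma card_allocation : #|{: allocation n}| = 'C(2 * n, n).
Proof.
rewrite card_sig -[in RHS](card_ord (2 * n)) -card_draws.
by apply: eq_card => A; rewrite !inE.
Qed.

Hypotheses (Y_rv : finite_valued_rv Y) (Y_uniform : uniform_allocation P Y).
Hypothesis XY : independent_of P Y X.

(** Splitting by the value of [Y], independence factors each term and the equal weights sum to 1, so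
    a bound uniform over fixed allocations survives randomisation. *)
Lemma prob_random_allocation (Q : allocation n -> ('I_(2 * n) -> R) -> Prop) (b : R) :
  (forall A, prob_at_most X (Q A) b) ->
  measurable [set w | Q (Y w) (fun i => X i w)] /\
  (P [set w | Q (Y w) (fun i => X i w)] <= b%:E)%E.
Proof.
move=> H; pose E A := Y @^-1` [set A] `&` [set w | Q A (fun i => X i w)].
have mE A : measurable (E A).
  apply: measurableI; first exact: Y_rv.
  by have [mQ _] := H A; apply: mQ => i; exact: measurable_funP.
have -> : [set w | Q (Y w) (fun i =>
  X i w)] = \big[setU/set0]_(A <- enum {: allocation n}) E A.
  rewrite -bigcup_seq; apply/seteqP; split => w /=.
    by move=> QY; exists (Y w); rewrite /= ?mem_enum.
  by move=> [A _ [/= -> ]].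
split; first exact: bigsetU_measurable.
apply: (@le_trans _ _ (\sum_(A <- enum {: allocation n}) P (E A))%E).
  elim: (enum _) => [|A s IH]; first by rewrite !big_nil measure0.
  rewrite !big_cons; apply: (le_trans (measureU2 _ _ _)) => //.
    exact: bigsetU_measurable.
  exact: leeD.
have C0 : (0 : R) < ('C(2 * n, n))%:R by rewrite ltr0n bin_gt0 leq_pmull.
apply: (@le_trans _ _ (\sum_(A <- enum {: allocation n}) ((('C(2 * n, n)%:R)^-1 * b)%:E))%E).
  apply: lee_sum => A _; have [mQ Qb] := H A.
  have := @XY A _ (g_sigma_preimage_condition mQ); rewrite -/(E A) => ->.
  by rewrite Y_uniform EFinM lee_pmul2l// lte_fin invr_gt0.
rewrite big_enum/= sumEFin sumr_const card_allocation lee_fin.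
by rewrite -[leLHS]mulr_natl mulrA divff ?mul1r ?gt_eqF.
Qed.

End Conditioning.

(** * The rate of the balance *)

Lemma nat_root_between (n : nat) : (0 < n)%N ->
  exists z : nat, (z ^ 20 <= n)%N /\ (n < z.+1 ^ 20)%N.
Proof.
move=> n0; have ex : exists z, (z ^ 20 <= n)%N by exists 0%N.
have ub z : (z ^ 20 <= n)%N -> (z <= n)%N.
  by apply: leq_trans; case: z => // z; rewrite -[leqLHS]expn1 leq_pexp2l.
have [z zn zmax] := ex_maxnP ex ub; exists z; split => //.
by rewrite ltnNge; apply/negP => /zmax; rewrite ltnn.
Qed.

Lemma dyadic_level (a b : nat) : (0 < a)%N -> (a <= b)%N ->
  exists J, (a * 2 ^ J <= b)%N /\ (b < 2 * (a * 2 ^ J))%N.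
Proof.
move=> a0 ab; have q0 : (0 < b %/ a)%N by rewrite divn_gt0.
have := trunc_log_bounds (isT : (1 < 2)%N) q0.
set J := trunc_log _ _ => /andP[J1 J2]; exists J; split.
  by rewrite mulnC -leq_divRL.
by rewrite mulnCA -expnS mulnC -ltn_divLR.
Qed.

Lemma rates_sum {R : realType} (u1 u2 u3 u4 l s z e : R) :
  (u1 + u1 + u2 + u3 + u3 + u3 + u4) / z <= e / 3 -> s <= e / 3 -> l <= e / 3 ->
  u1 / z + (u1 / z + (u2 / z + s + (u3 / z + (u3 / z + (u3 / z + (l + u4 / z)))))) <= e.
Proof. by rewrite !mulrDl; lra. Qed.

Lemma ratio_le_third {R : realType} (u z e : R) : 0 < z -> 0 < e -> 3 * u / e < z ->
  u / z <= e / 3.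
Proof. by move=> z0 e0; rewrite ltr_pdivrMr// ler_pdivrMr//; lra. Qed.

Lemma succ_le_3mul {R : realType} (p : R) : 1 <= p -> p + 1 <= 3 * p.
Proof. by lra. Qed.

Lemma succ_double_le_3mul {R : realType} (p : R) : 1 <= p -> 2 * p + 1 <= 3 * p.
Proof. by lra. Qed.

Theorem corollary1p2 (R : realType) (d : measure_display)
  (Omega : measurableType d) (P : probability Omega R)
  (f : R -> R)
  (X : forall n : nat, 'I_(2 * n) -> {RV P >-> R})
  (initial output : forall n : nat, Omega -> allocation n)
  (f_unif_continuous : unif_continuous f)
  (X_density : forall n i, has_density P (X n i) f)
  (X_independent : forall n, mutually_independent P (X n))
  (X_finite_variance : forall n i, ('V_P[X n i] < +oo)%E)
  (initial_rv : forall n, finite_valued_rv (initial n))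
  (initial_uniform : forall n, uniform_allocation P (initial n))
  (initial_independent : forall n, independent_of P (initial n) (X n))
  (output_rv : forall n, finite_valued_rv (output n))
  (output_greedy : forall n w,
     greedy_run (fun i => X n i w) (initial n w) (output n w)) :
  bigO_in_probability P
    (fun n w => balance (fun i => X n i w) (output n w))
    (fun n => n%:R ^- 3).
Proof.
move=> e e0.
(* There is no individual for n = 0, so the reference covariate is taken at n = 1. *)
pose X10 := X 1%N ord0.
have [ o fo0] := density_positive_somewhere (X_density 1%N ord0).
have fo2 : 0 < f o / 2 by rewrite divr_gt0.
have [dl dl0 fclose] := unif_continuous_near o f_unif_continuous fo2.
(* Within [dl] of [o] the density differs from [f o] by less than [f o / 2]; the 90 cells of width
   [dl / 100] to the right of [o] stay within this range. *)
pose lam := dl / 100; pose f0 := f o / 2; pose F := 2 * f o.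
have l0 : 0 < lam by rewrite divr_gt0.
have F0 : 0 <= F by rewrite mulr_ge0// ltW.
have law n i a b : o <= a -> a <= b -> b <= o + 90 * lam ->
    f0 * (b - a) <= pr P (X n i @^-1` [set` `[a, b[]) <= F * (b - a).
  move=> oa ab bo; apply: (density_interval (X_density n i)) => //; last exact: ltW.
  move=> t ta tb; have : `|f t - f o| < f o / 2.
    apply: fclose; rewrite ger0_norm; last by lra.
    by move: bo; rewrite /lam; lra.
  by rewrite ltr_norml /f0 /F => /andP[h1 h2]; apply/andP; split; lra.
have iid n i j (b : interval R) : P (X n i @^-1` [set` b]) = P (X n j @^-1` [set` b]).
  have mb : measurable [set` b] by exact: measurable_itv.
  have [_ _ hi] := X_density n i; have [_ _ hj] := X_density n j.
  exact: etrans (hi _ mb) (esym (hj _ mb)).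
pose c := fine 'E_P[X10]; pose M := fine 'V_P[X10].
have M_ge0 : 0 <= M by rewrite fine_ge0// variance_ge0.
have second n i : (\int[P]_w ((X n i w - c) ^+ 2)%:E <= M%:E)%E.
  apply: le_trans (finite_variance_second_moment (X_finite_variance 1%N ord0)).
  rewrite le_eqVlt; apply/orP; left; apply/eqP.
  apply: (same_density_integral (g := fun t =>
    (t - c) ^+ 2) (X_density n i) (X_density 1%N ord0)).
    by apply: measurable_funX; exact: measurable_funB.
  by move=> t; exact: sqr_ge0.
pose kappa := f0 * lam ^+ 2 / 2.
have k0 : 0 < kappa by rewrite divr_gt0// mulr_gt0// exprn_gt0.
(* [e] is split into thirds: [L] takes care of the quadratic error, [M0] of the sum over the fine
   scales, and [z0] of all the terms that vanish with n, gathered in [D]. *)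
pose L := 18 * M / (kappa * e) + 1.
have L0 : 0 < L.
  by apply: ltr_wpDl => //; apply: divr_ge0; apply: mulr_ge0 => //; exact: ltW.
have Lsmall : 6 * M / (kappa * L) <= e / 3.
  rewrite ler_pdivrMr ?mulr_gt0//.
  have -> : e / 3 * (kappa * L) = 6 * M + e / 3 * kappa.
    by rewrite /L; field; rewrite ?gt_eqF ?mulr_gt0.
  by rewrite lerDl; apply: mulr_ge0; [apply: divr_ge0 => //; exact: ltW|exact: ltW].
pose mm := (Num.truncn (12 * L / kappa)).+1.
have mmL : 12 * L <= f0 * lam ^+ 2 / 2 * mm%:R.
  rewrite -/kappa [leRHS]mulrC -ler_pdivrMr//; exact/ltW/truncnS_gt.
pose C1 := window_const lam f0 F.
pose M0 := (Num.truncn (264 * C1 / e)).+1.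
have M0R : (0 : R) < M0%:R by rewrite ltr0n.
have levels_small : 88 * C1 / M0%:R <= e / 3.
  rewrite ler_pdivrMr//; have : 264 * C1 / e < M0%:R by exact: truncnS_gt.
  by rewrite ltr_pdivrMr//; lra.
pose D := 720 / (f0 * lam) ^+ 2 + 720 / (f0 * lam) ^+ 2 +
  18 * mm%:R ^+ 2 * L ^+ 2 / kappa ^+ 2 +
  132 * C1 + 132 * C1 + 132 * C1 + 2 ^+ 60 * (8 * 22 * 100 * 64) * (F * lam) ^+ 3.
pose z0 := maxn 20 (maxn M0 (Num.truncn (3 * D / e)).+1).
pose s0 := Num.sqrt (f0 * lam ^+ 3 / 4).
have s0_gt0 : 0 < s0 by rewrite sqrtr_gt0 divr_gt0// mulr_gt0// exprn_gt0.
(* The final imbalance is at most 16 lam / (z^33 2^J), and J will satisfy n^2 < 2 z^33 M0 2^J,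
   whence 32 lam M0 / n^2; the balance divides this by at least n s0. *)
pose Mb := 32 * lam * M0%:R / s0.
have Mb0 : 0 <= Mb.
  by apply: divr_ge0; [apply: mulr_ge0 => //; apply: mulr_ge0 => //; exact: ltW|exact: ltW].
exists Mb; exists (z0 ^ 20)%N => //= n /= zn0.
have n0 : (0 < n)%N by apply: leq_trans zn0; rewrite expn_gt0 /z0 leq_max.
have [z [zn nz]] := nat_root_between n0.
have z0z : (z0 <= z)%N.
  by have := leq_ltn_trans zn0 nz; rewrite ltn_exp2r// ltnS.
have z20 : (20 <= z)%N by apply: leq_trans z0z; rewrite leq_max leqnn.
have zM0 : (M0 <= z)%N by apply: leq_trans z0z; rewrite !leq_max leqnn orbT.
have zD : 3 * D / e < z%:R.
  apply: lt_le_trans (truncnS_gt _) _; rewrite ler_nat.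
  by apply: leq_trans z0z; rewrite !leq_max leqnn !orbT.
have z1 : (0 < z)%N by apply: leq_trans z20.
have nz2 : (n <= (2 * z) ^ 20)%N.
  apply: (leq_trans (ltnW nz)); rewrite leq_exp2r//.
  by rewrite mul2n -addnn -addn1 leq_add2l.
have n0R : (0 : R) < n%:R by rewrite ltr0n.
(* Such a J exists because M0 <= z <= z^7 and z^40 <= n^2. *)
have [J [J1 J2]] : exists J, (z ^ 33 * M0 * 2 ^ J <=
  n ^ 2)%N /\ (n ^ 2 < 2 * (z ^ 33 * M0 * 2 ^ J))%N.
  apply: dyadic_level; first by rewrite muln_gt0 expn_gt0 z1.
  apply: (@leq_trans (z ^ 33 * z ^ 7));
    last by rewrite -expnD (_ : 33 + 7 = 20 * 2)%N// expnM leq_exp2r.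
  rewrite leq_mul2l (leq_trans zM0) ?orbT//.
  by rewrite -[leqLHS]expn1 leq_pexp2l.
have J1' : (z ^ 33 * 2 ^ J * M0 <= n ^ 2)%N by rewrite mulnAC.
(* With n ~ z^20 the three jumps reach scales z^-18, z^-28 and z^-33.  A jump from
   scale H to scale w tries H / w targets, each failing with probability of order
   1 / (n^2 w) + 1 / n, while close triples at scale w have probability of order
   n^3 w^2; each of these is here a negative power of z. *)
pose bad (A : allocation n) := bad_event (val A) o lam f0 (z ^ 18) (z ^ 28) (z ^ 33)
  (2 * z ^ 10) (2 * z ^ 5) J.
have two_le a b : (a < b)%N -> (2 * z ^ a <= z ^ b)%N.
  move=> ab; apply: (@leq_trans (z * z ^ a));
    first by rewrite leq_mul2r (leq_trans _ z20) ?orbT.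
  by rewrite -expnS leq_pexp2l.
have z33 : (20 <= z ^ 33)%N by apply: (leq_trans z20); rewrite -[leqLHS]expn1 leq_pexp2l.
have zpow k : (0 < z ^ k)%N by rewrite expn_gt0 z1.
have Q2 : (2 * z ^ 10 <= z ^ 28)%N by exact: two_le.
have Q3 : (2 * z ^ 5 <= z ^ 33)%N by exact: two_le.
have Z0 : (0 : R) < z%:R by rewrite ltr0n.
have z4 : (4 <= z)%N by apply: leq_trans z20.
have jump Q m a b : (Q.+1)%:R <= 3 * (z%:R : R) ^+ a -> m%:R <= (z%:R : R) ^+ b ->
    (20 <= b)%N -> (a + b < 40)%N ->
    \sum_(q < Q.+1) (22 * window_bound (n := n) lam f0 F m) <= 132 * C1 / z%:R.
  exact: jump_bound_le.
have badP A : prob_at_most (X n) (bad A) e.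
  have := prob_bad_event (X_independent n) l0 (fo2 : 0 < f0) n0 (law n) (iid n)
    (second n) L0 (isT : (0 < mm)%N) mmL J (eqP (valP A)) (zpow 18) (zpow 28) z33 Q2 Q3.
  apply: prob_at_most_le.
  have inv : n%:R^-1 <= z%:R^-1 :> R by exact: inv_n_le.
  have t1 : 90 * (8 / (n%:R * (f0 * lam) ^+ 2)) <= 720 / (f0 * lam) ^+ 2 / z%:R.
    have -> : 90 * (8 / (n%:R * (f0 * lam) ^+ 2)) = 720 / (f0 * lam) ^+ 2 / n%:R.
      by field; rewrite !gt_eqF// mulr_gt0.
    apply: ler_wpM2l inv; apply: divr_ge0; [exact: ler0n|exact: sqr_ge0].
  have t2 : 18 * mm%:R ^+ 2 * L ^+ 2 / ((f0 * lam ^+ 2 / 2) ^+ 2 * n%:R) <=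
      18 * mm%:R ^+ 2 * L ^+ 2 / kappa ^+ 2 / z%:R.
    rewrite -/kappa invfM mulrA; apply: ler_wpM2l inv; apply: divr_ge0; last exact: sqr_ge0.
    apply: mulr_ge0; last exact: sqr_ge0.
    by apply: mulr_ge0; [exact: ler0n|exact: sqr_ge0].
  have pow a : 1 <= (z%:R : R) ^+ a by rewrite -natrX ler1n.
  have j1 : \sum_(q < (z ^ 18).+1) (22 * window_bound (n := n) lam f0 F (z ^ 18)) <=
    132 * C1 / z%:R.
    apply: (jump _ _ 18%N 20%N) => //; last by rewrite natrX ler_weXn2l// ler1n.
    by rewrite -natr1 natrX; exact: succ_le_3mul.
  have j2 : \sum_(q < (2 * z ^ 10).+1) (22 * window_bound (n := n) lam f0 F (z ^ 28)) <=
    132 * C1 / z%:R.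
    apply: (jump _ _ 10%N 28%N) => //; last by rewrite natrX.
    by rewrite -natr1 natrM natrX; exact: succ_double_le_3mul.
  have j3 : \sum_(q < (2 * z ^ 5).+1) (22 * window_bound (n := n) lam f0 F (z ^ 33)) <=
    132 * C1 / z%:R.
    apply: (jump _ _ 5%N 33%N) => //; last by rewrite natrX.
    by rewrite -natr1 natrM natrX; exact: succ_double_le_3mul.
  have lv := level_bound_le l0 (fo2 : 0 < f0) F0 z4 zn nz2 (isT : (0 < M0)%N) J1'.
  have tr := triple_bound_le l0 F0 z4 zn nz2.
  have Dz : D / z%:R <= e / 3 by exact: ratio_le_third.
  apply: (le_trans (lerD t1 (lerD t1 (lerD (lerD t2 (lexx _)) (lerD j1 (lerD j2 (lerD j3
    (lerD (le_trans lv levels_small) tr)))))))).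
  exact: rates_sum Dz Lsmall (lexx _).
have [mBad PBad] := prob_random_allocation (initial_rv n) (initial_uniform n)
  (initial_independent n) badP.
pose t := Mb / n%:R ^+ 3.
have t0 : 0 <= t by rewrite divr_ge0// exprn_ge0// ltW.
have ratioE b : 0 <= b -> (Mb < `|b / n%:R ^- 3|) = (t < b).
  move=> b0; rewrite invrK ger0_norm ?mulr_ge0 ?exprn_ge0 ?(ltW n0R)//.
  by rewrite /t [RHS]ltr_pdivrMr ?exprn_gt0.
have balance_ge0 w : 0 <= balance (fun i => X n i w) (output n w) by exact: normr_ge0.
apply: le_trans PBad; apply: le_measure; rewrite ?inE//.
  (* The output depends on the initial allocation and on choices among ties, so measurability is
     obtained by splitting over its finitely many values. *)
  have -> : [set w | Mb < `|balance (fun i => X n i w) (output n w) / n%:R ^- 3|] =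
      \bigcup_B (output n @^-1` [set B] `&` [set w | t < balance (fun i => X n i w) B]).
    apply/seteqP; split => w /=.
      by rewrite ratioE// => tb; exists (output n w).
    by move=> [B _ [/= -> tb]]; rewrite ratioE//; exact: normr_ge0.
  apply: countable_bigcupT_measurable; first exact: countableP.
  move=> B; apply: measurableI; first exact: output_rv.
  by apply: (measurable_condition_balance B n0 t0) => i; exact: measurable_funP.
move=> w /=; rewrite ratioE// => big; apply: contrapT => good; move: big; apply/negP;
  rewrite -leNgt.
have e1 : (16 <= z ^ 18)%N.
  apply: (@leq_trans z); first exact: leq_trans z20.
  by rewrite -[leqLHS]expn1 leq_pexp2l.
have e2 : (2 * z ^ 28 <= 2 * z ^ 10 * z ^ 18)%N by rewrite -mulnA -expnD.
have e3 : (2 * z ^ 33 <= 2 * z ^ 5 * z ^ 28)%N by rewrite -mulnA -expnD.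
have e4 : (3 <= z ^ 33)%N by apply: leq_trans z33.
apply: (le_trans (greedy_balance_bound n0 l0 (fo2 :
  0 < f0) (output_greedy n w) e1 (zpow 28) e4 e2 e3 Q2 Q3 good)).
have a0 : (0 : R) < (z ^ 33 * 2 ^ J)%:R by rewrite ltr0n muln_gt0 zpow expn_gt0.
have J2R : n%:R ^+ 2 <= 2 * ((z ^ 33 * 2 ^ J)%:R * M0%:R) :> R.
  by rewrite -natrX -!natrM ler_nat ltnW// mulnAC.
rewrite -/s0 /t /Mb.
set a : R := (z ^ 33 * 2 ^ J)%:R in a0 J2R *.
rewrite ler_pdivrMr ?mulr_gt0// ler_pdivrMr//.
have -> : 32 * lam * M0%:R / s0 / n%:R ^+ 3 * (n%:R * s0) * a =
  16 * lam * (2 * (a * M0%:R) / n%:R ^+ 2).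
  by field; rewrite !gt_eqF.
by rewrite ler_pMr ?mulr_gt0// ler_pdivlMr ?exprn_gt0// mul1r.
Qed.
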